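(* Let $A=\bigoplus_nA_n$ be the left Hopf kernel of $\Lambda:\mathfrak{S}Sym\to\mathcal{Y}Sym$ and $B=\bigoplus_nB_n$ the left Hopf kernel of $\mathcal{L}:\mathcal{Y}Sym\to\mathcal{Q}Sym$. For $n>0$: a basis of $A_n$ is $\{M_\tau:\tau\in\mathfrak{S}_n\text{ whose last component is not }132\text{-avoiding}\}$, and a basis of $B_n$ is $\{M_t:t\in\mathcal{Y}_n\text{ whose last component is not a right comb}\}$. In particular $$\dim A_n=n!-\sum_{k=0}^{n-1}k!\,c_{n-k-1},\qquad \dim B_n=c_n-\sum_{k=0}^{n-1}c_k,$$ where $c_k=\#\mathcal{Y}_k=\frac{(2k)!}{k!(k+1)!}$ is the $k$-th Catalan number.
   Context: Permutations in one-line notation; $\mathrm{st}$ standardizes sequences of distinct integers. Weak order on $\mathfrak{S}_n$: inclusion of inversion sets. $\sigma\vee\tau=(\sigma(1)+q,..,\sigma(p)+q,p+q+1,\tau(1),..,\tau(q))$, $\sigma\backslash\tau=(\sigma(1)+q,..,\sigma(p)+q,\tau(1),..,\tau(q))$ for $\sigma\in\mathfrak{S}_p,\tau\in\mathfrak{S}_q$. A permutation $\rho\ne\mathrm{id}_0$ has no global descents if its only decompositions $\rho=\sigma\backslash\tau$ are with $\sigma$ or $\tau$ empty; every $\tau\in\mathfrak{S}_n$, $n>0$, is uniquely $\tau_1\backslash\cdots\backslash\tau_k$ with each $\tau_i$ having no global descents, and $\tau_k$ is its last component. 132-avoiding: no $i<j<k$ with $\sigma(i)<\sigma(k)<\sigma(j)$.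 $\mathrm{Des}(\sigma)=\{i:\sigma(i)>\sigma(i+1)\}$. Trees: $\mathcal{Y}_n$ = rooted planar binary trees with $n$ internal nodes, $\mathcal{Y}_0=\{|\}$; $s\vee t$ = root with left subtree $s$ and right subtree $t$; Tamari order generated by replacing a subtree $(a\vee b)\vee c$ by the larger $a\vee(b\vee c)$; $|\backslash t=t$, $s\backslash t=s_l\vee(s_r\backslash t)$. $t\ne|$ is progressive if $t_r=|$; every $t\ne|$ is uniquely $t_1\backslash\cdots\backslash t_l$ with $t_i$ progressive; $t_l$ is its last component. Right combs: $1_0=|$, $1_n=1_{n-1}\vee|$. $L(t)$: with leaves numbered $0..n$, the $i\in[n-1]$ such that leaf $i$ is a left child. $\lambda(\mathrm{id}_0)=|$, $\lambda(\sigma)=\lambda(\mathrm{st}(\sigma(1..j-1)))\vee\lambda(\mathrm{st}(\sigma(j+1..n)))$ with $j=\sigma^{-1}(n)$. Hopf algebras over $\mathbb{Q}$: $\mathfrak{S}Sym$ with basis $F_\sigma$, coproduct $\Delta(F_\sigma)=\sum_{p}F_{\mathrm{st}(\sigma(1..p))}\otimes F_{\mathrm{st}(\sigma(p+1..n))}$, $M_\sigma=\sum_{\sigma\le\tau}\mu_{\mathfrak{S}_n}(\sigma,\tau)F_\tau$; $\mathcal{Y}Sym$ with basis $F_t$, coproduct $\Delta(F_t)=\sum_iF_{t_0}\otimes F_{t_1}$ over splittings at leaves $i=0..n$ (recursively: $|\to(|,|)$; for $t=t_l\vee t_r$, $t\to(a,b\vee t_r)$ if the leaf is in $t_l$ and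 $t_l\to(a,b)$, $t\to(t_l\vee c,d)$ if in $t_r$ and $t_r\to(c,d)$), $M_t=\sum_{t\le s}\mu_{\mathcal{Y}_n}(t,s)F_s$; $\mathcal{Q}Sym$ with bases $F_{\mathsf{S}}=\sum_{\mathsf{T}\supseteq\mathsf{S}}M_{\mathsf{T}}$ ($\mathsf{S}\subseteq[n-1]$). $\Lambda(F_\sigma)=F_{\lambda(\sigma)}$ and $\mathcal{L}(F_t)=F_{L(t)}$ are surjective Hopf algebra morphisms. The left Hopf kernel of a Hopf morphism $\pi:H\to K$ is $\{h\in H:\sum h_{(1)}\otimes\pi(h_{(2)})=h\otimes1\}$ (Sweedler notation), graded by degree. *)

(* Defs.v *)
(* Concrete model of the graded pieces of SSym, YSym, QSym
   over rat, with homogeneous components as row vectors indexed by explicit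
   enumerations of the F-bases. *)
From HB Require Import structures.
From mathcomp Require Import all_boot all_order all_algebra.
Set Implicit Arguments. Unset Strict Implicit. Unset Printing Implicit Defensive.
Import Order.TTheory GRing.Theory Num.Theory.

(* Generic finite-poset Moebius function (E duplicate-free list of the  *)
(* elements, le the order relation).                                   *)
Fixpoint mobius_aux (T : eqType) (le : rel T) (E : seq T) (k : nat) (x y : T)
    : rat :=
  if x == y then 1%R else
  match k with
  | 0 => 0%R
  | k'.+1 =>
      if le x y then
        (- \sum_(z <- E | le x z && le z y && (z != y)) mobius_aux le E k' x z)%R
      else 0%R
  end.
(* fuel size E exceeds the length of any chain *)
Definition mobius (T : eqType) (le : rel T) (E : seq T) (x y : T) : rat :=
  mobius_aux le E (size E) x y.

(* Generic left Hopf kernel of pi : H -> K in degree n.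
   bH p / bK q : enumerations of the F-bases of H_p and K_q;
   cop x : the terms of (id (x) pi)(Delta F_x), as pairs of basis indices;
   unitK : the index of 1 = F_unitK in K_0.
   An element h of H_n is a row vector of F-coordinates; the tensor space
   (truncated to degrees <= n) is coordinatised by pairs of basis indices. *)
Section HopfKernel.
Variables (X Y : eqType) (x0 : X) (y0 : Y).
Variables (bH : nat -> seq X) (bK : nat -> seq Y).
Variables (cop : X -> seq (X * Y)) (unitK : Y).

Definition tens_idx (n : nat) : seq (X * Y) :=
  [seq (x, y) | x <- flatten [seq bH p | p <- iota 0 n.+1],
                y <- flatten [seq bK q | q <- iota 0 n.+1]].

(* row k : coordinates of  (id (x) pi) Delta(F_x) - F_x (x) 1 ,  x = k-th basis elt *)
Definition kerMat (n : nat) : 'M[rat]_(size (bH n), size (tens_idx n)) :=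
  \matrix_(k, l)
    ((count (pred1 (nth (x0, y0) (tens_idx n) l)) (cop (nth x0 (bH n) k)))%:R
     - (nth (x0, y0) (tens_idx n) l == (nth x0 (bH n) k, unitK))%:R)%R.

(* A_n = { h in H_n | sum h(1) (x) pi(h(2)) = h (x) 1 } *)
Definition hopf_kernel (n : nat) : {vspace 'rV[rat]_(size (bH n))} :=
  lker (linfun (mulmxr (kerMat n))).

Definition Mvec (n : nat) (le : rel X) (x : X) : 'rV[rat]_(size (bH n)) :=
  \row_i (if le x (nth x0 (bH n) i) then mobius le (bH n) x (nth x0 (bH n) i)
          else 0%R).
End HopfKernel.

(* Permutations: one-line notation, values 1..n, as seq nat.          *)
Definition perms (n : nat) : seq (seq nat) := permutations (iota 1 n).

Definition st (s : seq nat) : seq nat :=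
  [seq (count (fun y => y < x) s).+1 | x <- s].

Definition inv_set (s : seq nat) : seq (nat * nat) :=
  [seq ij <- [seq (i, j) | i <- iota 0 (size s), j <- iota 0 (size s)]
     | (ij.1 < ij.2) && (nth 0 s ij.2 < nth 0 s ij.1)].
Definition weak_le (s t : seq nat) : bool := all (mem (inv_set t)) (inv_set s).

(* p is a position where s = s1 \ s2 with |s1| = p, s1, s2 nonempty *)
Definition is_gdesc (s : seq nat) (p : nat) : bool :=
  (0 < p < size s) &&
  all (fun x => all (fun y => y < x) (drop p s)) (take p s).

(* last component of the unique decomposition s = s_1 \ ... \ s_k *)
Definition last_comp_perm (s : seq nat) : seq nat :=
  st (drop (foldr maxn 0 [seq p <- iota 0 (size s) | is_gdesc s p]) s).

Definition avoids132 (s : seq nat) : bool :=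
  all (fun i => all (fun j => all (fun k =>
     ~~ [&& i < j, j < k, nth 0 s i < nth 0 s k & nth 0 s k < nth 0 s j])
     (iota 0 (size s))) (iota 0 (size s))) (iota 0 (size s)).

Inductive tree := Leaf | Node of tree & tree.

Fixpoint tree_eqb (s t : tree) : bool :=
  match s, t with
  | Leaf, Leaf => true
  | Node a b, Node c d => tree_eqb a c && tree_eqb b d
  | _, _ => false
  end.

Lemma tree_eqP : Equality.axiom tree_eqb.
Proof.
elim=> [|a IHa b IHb] [|c d] /=; try by constructor.
apply: (iffP andP) => [[/IHa -> /IHb ->] //|[<- <-]].
by split; [apply/IHa | apply/IHb].
Qed.

HB.instance Definition _ := hasDecEq.Build tree tree_eqP.

Fixpoint nodes (t : tree) : nat :=
  match t with Leaf => 0 | Node l r => (nodes l + nodes r).+1 end.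

(* enumeration of Y_n (fuel f >= n) *)
Fixpoint trees_aux (f n : nat) : seq tree :=
  match n, f with
  | 0, _ => [:: Leaf]
  | n'.+1, 0 => [::]
  | n'.+1, f'.+1 =>
      flatten [seq [seq Node l r | l <- trees_aux f' k, r <- trees_aux f' (n' - k)]
              | k <- iota 0 n'.+1]
  end.
Definition trees (n : nat) : seq tree := trees_aux n n.

Fixpoint rot (t : tree) : seq tree :=
  match t with
  | Leaf => [::]
  | Node l r =>
      (match l with Node a b => [:: Node a (Node b r)] | Leaf => [::] end)
      ++ [seq Node l' r | l' <- rot l] ++ [seq Node l r' | r' <- rot r]
  end.

Fixpoint reach (k : nat) (t : tree) : seq tree :=
  match k with
  | 0 => [:: t]
  | k'.+1 => t :: flatten [seq reach k' u | u <- rot t]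
  end.

(* Tamari order: reflexive-transitive closure of rotation; a path of length
   size (trees (nodes s)) suffices since Y_n is finite *)
Definition tamari_le (s t : tree) : bool :=
  t \in reach (size (trees (nodes s))) s.

(* lambda : permutations -> trees (decreasing binary tree shape) *)
Fixpoint lam_aux (f : nat) (s : seq nat) : tree :=
  match f with
  | 0 => Leaf
  | f'.+1 =>
      if s is [::] then Leaf else
      let j := index (size s) s in
      Node (lam_aux f' (st (take j s))) (lam_aux f' (st (drop j.+1 s)))
  end.
Definition lam (s : seq nat) : tree := lam_aux (size s) s.

(* splittings of a tree along the leaves 0..n *)
Fixpoint split_tree (t : tree) : seq (tree * tree) :=
  match t with
  | Leaf => [:: (Leaf, Leaf)]
  | Node l r =>
      [seq (ab.1, Node ab.2 r) | ab <- split_tree l]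
      ++ [seq (Node l cd.1, cd.2) | cd <- split_tree r]
  end.

Fixpoint leaf_flags (t : tree) (b : bool) : seq bool :=
  match t with
  | Leaf => [:: b]
  | Node l r => leaf_flags l true ++ leaf_flags r false
  end.

Definition Ldes (t : tree) : seq nat :=
  [seq i <- iota 1 (nodes t).-1 | nth false (leaf_flags t false) i].

(* F-basis index of QSym_m : (m, X) with X subset of [m-1], increasing *)
Fixpoint powerlist (s : seq nat) : seq (seq nat) :=
  match s with
  | [::] => [:: [::]]
  | x :: s' => [seq x :: u | u <- powerlist s'] ++ powerlist s'
  end.
Definition qsym_basis (m : nat) : seq (nat * seq nat) :=
  [seq (m, X) | X <- powerlist (iota 1 m.-1)].

(* last component of the unique decomposition into progressive trees *)
Fixpoint last_comp_tree (t : tree) : tree :=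
  match t with
  | Leaf => Leaf
  | Node l Leaf => Node l Leaf
  | Node l r => last_comp_tree r
  end.

(* right combs 1_n = 1_{n-1} v | *)
Fixpoint is_comb (t : tree) : bool :=
  match t with Leaf => true | Node l r => (r == Leaf) && is_comb l end.

(* (id (x) Lambda) o Delta on F_sigma  and (id (x) L) o Delta on F_t  *)
Definition copS (s : seq nat) : seq (seq nat * tree) :=
  [seq (st (take p s), lam (st (drop p s))) | p <- iota 0 (size s).+1].

Definition copY (t : tree) : seq (tree * (nat * seq nat)) :=
  [seq (ab.1, (nodes ab.2, Ldes ab.2)) | ab <- split_tree t].

Definition A_kernel (n : nat) :=
  hopf_kernel [::] Leaf perms trees copS Leaf n.
Definition B_kernel (n : nat) :=
  hopf_kernel Leaf (0, [::]) trees qsym_basis copY (0, [::]) n.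

Definition MS (n : nat) (s : seq nat) := Mvec [::] perms n weak_le s.
Definition MY (n : nat) (t : tree) := Mvec Leaf trees n tamari_le t.

Definition catalan (k : nat) : nat := (k.*2)`! %/ (k`! * k.+1`!).

(* Main.v *)
(** Write [F_x = sum_(y >= x) M_y], so that the [M]-coordinate of [h] at [y] is
    [c_y(h) = sum_(x <= y) h_x].  Both coproducts are governed by an adjunction
    [x <= mul u v <-> x' <= u /\ x'' <= v], where [(x', x'')] is the cut of [x] at
    position [deg u] with [x''] pushed to the quotient: [mul u v] is the graft of [u]
    with the largest element of the fibre over [v].  Summing the kernel equation over
    the order ideal below [(u, v)] turns it into [c_(mul u v)(h) = 0] for [deg v > 0];
    hence the kernel is spanned by the [M_x] with [x] not of the form [mul u v].

    Trees are compared through the vector [lv] of left subtree sizes in inorder: the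
    Tamari order is the reversed pointwise order on these vectors, splitting truncates
    them, grafting concatenates them, and [i] is in [L(t)] iff entry [i] vanishes. *)
Require Import Defs.
From HB Require Import structures.
From mathcomp Require Import all_boot all_order all_algebra.
From mathcomp Require Import zify ring.

Set Implicit Arguments.
Unset Strict Implicit.
Unset Printing Implicit Defensive.
Import GRing.Theory.

(** * Moebius inversion and Hopf kernels *)

(** A decomposition [x = mul u v] need not be unique, so the excluded indices cannot be counted by
    pairs [(u, v)]; the last component identifies them. For trees the largest element of a fibre is
    a graft of right combs, and all combs but the last can be absorbed into [u]: the size of the
    last comb then leaves c_k choices for the rest. For permutations the largest elements of the
    fibres of [lam] are the 132-avoiding ones. Such a permutation may have global descents of its
    own, but its suffixes avoid 132 too, so only the last component of [x] matters. The count uses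
    another normal form: absorbing all progressive factors of [v] but the last into [u] leaves a
    tree with root over [l] and a leaf, with [l] free among the trees with n-k-1 nodes, whence the
    products k! c_{n-k-1}. *)

Definition poset_on (T : eqType) (E : seq T) (le : rel T) : Prop :=
  [/\ uniq E, {in E, reflexive le}, {in E &, antisymmetric le}
    & {in E & &, transitive le}].

Section Mobius.
Variables (T : eqType) (x0 : T) (le : rel T) (E : seq T).
Hypothesis posE : poset_on E le.

Let uniqE : uniq E. Proof. by case: posE. Qed.
Let le_refl : {in E, reflexive le}. Proof. by case: posE. Qed.
Let le_anti : {in E &, antisymmetric le}. Proof. by case: posE. Qed.
Let le_trans : {in E & &, transitive le}. Proof. by case: posE. Qed.

Definition below (x y : T) : nat :=
  count (fun z => le x z && le z y && (z != y)) E.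

Lemma below_gt0 x y : x \in E -> le x y -> x != y -> 0 < below x y.
Proof.
move=> xE xy nxy; rewrite -has_count; apply/hasP; exists x => //.
by rewrite le_refl // xy nxy.
Qed.

Lemma below_lt x y z : x \in E -> y \in E -> z \in E ->
  le x z -> le z y -> z != y -> below x z < below x y.
Proof.
move=> xE yE zE xz zy nzy; rewrite /below -!size_filter.
apply: (@leq_trans (size (z :: [seq w <- E | le x w && le w z && (w != z)]))) => //.
apply: uniq_leq_size.
  by rewrite /= filter_uniq // mem_filter eqxx !andbF.
move=> w; rewrite inE mem_filter => /orP [/eqP -> | /andP [/andP [/andP [xw wz] nwz] wE]].
  by rewrite mem_filter xz zy nzy.
rewrite mem_filter xw wE (le_trans _ _ _ wz zy) //= andbT.
apply/eqP => wy; move: nwz; rewrite wy => /eqP; apply.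
by apply: le_anti => //; rewrite zy -wy wz.
Qed.

(** The recursion at [y] calls only [z] strictly below [y], where [below x z] is smaller, so any
    fuel of at least [below x y] gives the same value. As [below] never exceeds [size E], the fuel
    in [mobius] is enough. *)
Lemma mobius_aux_fuel x y k k' : x \in E -> y \in E ->
  below x y <= k -> below x y <= k' ->
  mobius_aux le E k x y = mobius_aux le E k' x y.
Proof.
move=> xE; elim: k k' y => [|k IH] k' y yE.
  rewrite leqn0 => /eqP b0 _; case: k' => [|k'] //=.
  case: eqP => // /eqP nxy; case: ifP => // xy.
  by have := below_gt0 xE xy nxy; rewrite b0.
case: k' => [|k'] bk bk' /=; case: eqP => // /eqP nxy.
  case: ifP => // xy.
  by have := below_gt0 xE xy nxy; move: bk'; rewrite leqn0 => /eqP ->.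
case: ifP => // xy; congr (- _)%R.
rewrite big_seq_cond [RHS]big_seq_cond; apply: eq_bigr => z.
case/andP=> zE /andP [/andP [xz zy] nzy].
have lt := below_lt xE yE zE xz zy nzy.
by apply: IH => //; rewrite -ltnS; apply: leq_trans lt _.
Qed.

Lemma mobius_sum x y : x \in E -> y \in E ->
  (\sum_(z <- E | le x z && le z y) mobius le E x z = (x == y)%:R)%R.
Proof.
move=> xE yE; have [<- | nxy] := eqVneq x y.
  rewrite -big_filter (bigD1_seq x) ?mem_filter ?filter_uniq ?le_refl //= big_filter_cond.
  rewrite big_seq_cond big1 ?addr0.
    by rewrite /mobius; case: (size E) => [|k] /=; rewrite eqxx.
  move=> z /andP [zE /andP [/andP [xz zx] nzx]].
  by case/eqP: nzx; apply: le_anti => //; rewrite xz zx.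
case xy: (le x y); last first.
  rewrite big_seq_cond big1 // => z /andP [zE /andP [xz zy]].
  by rewrite (le_trans _ _ _ xz zy) in xy.
rewrite -big_filter (bigD1_seq y) ?mem_filter ?filter_uniq ?xy ?le_refl //=.
rewrite big_filter_cond.
(* Unfolding the recursion once leaves fuel [(size E).-1], which still suffices because
   [below x z < below x y <= size E]. *)
have sE : size E = (size E).-1.+1 by case: (E) xE.
rewrite {1}/mobius sE /= (negPf nxy) xy /= addrC; apply/eqP; rewrite subr_eq0.
apply/eqP; rewrite big_seq_cond [RHS]big_seq_cond; apply: eq_bigr => z.
case/andP=> zE /andP [/andP [xz zy] nzy]; rewrite /mobius.
have lt := below_lt xE yE zE xz zy nzy.
apply: mobius_aux_fuel => //; first exact: count_size.
by rewrite -ltnS -sE; apply: leq_trans lt _; apply: count_size.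
Qed.

Definition zetamx : 'M[rat]_(size E) :=
  (\matrix_(i, j) (le (nth x0 E i) (nth x0 E j))%:R)%R.

Definition mobiusmx : 'M[rat]_(size E) :=
  (\matrix_(i, j) if le (nth x0 E i) (nth x0 E j)
                  then mobius le E (nth x0 E i) (nth x0 E j) else 0)%R.

Lemma sum_nth_ord (F : T -> rat) :
  (\sum_(i < size E) F (nth x0 E i) = \sum_(x <- E) F x)%R.
Proof. by rewrite (big_nth x0) big_mkord. Qed.

Lemma mul_mobius_zeta : (mobiusmx *m zetamx = 1%:M)%R.
Proof.
apply/matrixP => i j; rewrite !mxE.
set x := nth x0 E i; set y := nth x0 E j.
transitivity (\sum_(z <- E | le x z && le z y) mobius le E x z)%R.
  rewrite [RHS]big_mkcond -sum_nth_ord; apply: eq_bigr => k _; rewrite !mxE -/x -/y.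
  by case: (le x _); case: (le _ y); rewrite /= ?mulr1 ?mulr0 ?mul0r.
by rewrite mobius_sum ?mem_nth // nth_uniq.
Qed.

Lemma zetamx_unit : zetamx \in unitmx.
Proof. by case: (mulmx1_unit mul_mobius_zeta). Qed.

(** A one-sided inverse of a square matrix is two-sided. In this order the product expands each F_x
    as the sum of the M_y with y above x. *)
Lemma mul_zeta_mobius : (zetamx *m mobiusmx = 1%:M)%R.
Proof. exact: mulmx1C mul_mobius_zeta. Qed.

End Mobius.

(** Passes from matrix products over an enumerated basis to sums over a list of coproduct terms, in
    which a term may be repeated. *)
Lemma sum_count_nth (T : eqType) (x0 : T) (E s : seq T) (f : T -> rat) :
  uniq E -> {subset s <= E} ->
  (\sum_(j < size E) (count (pred1 (nth x0 E j)) s)%:R * f (nth x0 E j)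
   = \sum_(t <- s) f t)%R.
Proof.
move=> uE; elim: s => [|t s IH] sE.
  by rewrite big_nil big1 // => j _; rewrite mul0r.
rewrite big_cons -IH; last by move=> z zs; apply: sE; rewrite inE zs orbT.
have tE : t \in E by apply: sE; rewrite inE eqxx.
have lt : index t E < size E by rewrite index_mem.
transitivity (\sum_(j < size E) ((t == nth x0 E j)%:R * f (nth x0 E j)
   + (count (pred1 (nth x0 E j)) s)%:R * f (nth x0 E j)))%R.
  by apply: eq_bigr => j _ /=; rewrite natrD mulrDl.
rewrite big_split /=; congr (_ + _)%R.
rewrite (bigD1 (Ordinal lt)) //= nth_index // eqxx mul1r big1 ?addr0 // => j nj.
case: eqP => [tj|]; last by rewrite mul0r.
by case/eqP: nj; apply: val_inj; rewrite /= tj index_uniq.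
Qed.

(** * Hopf kernels cut out by an adjunction *)

Section Kernel.
Variables (X Y : eqType) (x0 : X) (y0 : Y).
Variables (bH : nat -> seq X) (bK : nat -> seq Y).
Variables (cop : X -> seq (X * Y)) (unitK : Y).
Variables (dX : X -> nat) (dY : Y -> nat) (leX : rel X) (leY : rel Y).
Variables (cutl : nat -> X -> X) (cutr : nat -> X -> Y) (mul : X -> Y -> X).
Hypothesis posX : forall p, poset_on (bH p) leX.
Hypothesis posY : forall p, poset_on (bK p) leY.
Hypothesis degX : forall p x, x \in bH p -> dX x = p.
Hypothesis degY : forall p y, y \in bK p -> dY y = p.
Hypothesis copE : forall n x, x \in bH n ->
  cop x = [seq (cutl p x, cutr p x) | p <- iota 0 n.+1].
Hypothesis cutlP : forall n p x, x \in bH n -> p <= n -> cutl p x \in bH p.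
Hypothesis cutrP : forall n p x, x \in bH n -> p <= n -> cutr p x \in bK (n - p).
Hypothesis mulP : forall p q u v, u \in bH p -> v \in bK q -> mul u v \in bH (p + q).
Hypothesis mul_adj : forall p q x u v,
  x \in bH (p + q) -> u \in bH p -> v \in bK q ->
  leX x (mul u v) = leX (cutl p x) u && leY (cutr p x) v.
Hypothesis unitP : bK 0 = [:: unitK].
Hypothesis mul_unit : forall p u, u \in bH p -> mul u unitK = u.

Variable n : nat.

(** The degree tests make different degrees incomparable: the tensor index mixes all degrees up to
    [n], while [leX] and [leY] are known to be orders only inside one degree (inclusion of descent
    sets ignores the degree). *)
Let le2 (s t : X * Y) : bool :=
  [&& dX s.1 == dX t.1, dY s.2 == dY t.2, leX s.1 t.1 & leY s.2 t.2].

Lemma mem_graded (Z : eqType) (b : nat -> seq Z) z :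
  reflect (exists2 p, p <= n & z \in b p)
          (z \in flatten [seq b p | p <- iota 0 n.+1]).
Proof.
apply: (iffP flatten_mapP) => [] [p]; rewrite ?mem_iota => hp zp; exists p => //.
by rewrite mem_iota.
Qed.

Lemma mem_tens_idx t :
  reflect (exists p q, [/\ p <= n, q <= n, t.1 \in bH p & t.2 \in bK q])
          (t \in tens_idx bH bK n).
Proof.
apply: (iffP allpairsP) => [[[x y] /= [/mem_graded [p hp xp] /mem_graded [q hq yq] ->]]|].
  by exists p, q.
case=> p [q [hp hq h1 h2]]; exists t; split; last by case: t {h1 h2}.
  by apply/mem_graded; exists p.
by apply/mem_graded; exists q.
Qed.

Lemma uniq_graded (Z : eqType) (b : nat -> seq Z) (d : Z -> nat) :
  (forall p, uniq (b p)) -> (forall p z, z \in b p -> d z = p) ->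
  uniq (flatten [seq b p | p <- iota 0 n.+1]).
Proof.
move=> ub db; have := iota_uniq 0 n.+1; elim: (iota 0 n.+1) => //= p s IH /andP [ps us].
rewrite cat_uniq ub IH // andbT /=; apply/hasPn => z /flatten_mapP [q qs zq].
by apply: contra ps => zp; rewrite -(db _ _ zp) (db _ _ zq).
Qed.

Lemma tens_idx_poset : poset_on (tens_idx bH bK n) le2.
Proof.
split.
- apply: allpairs_uniq => [||[a b] [c d] _ _ /= [-> ->]] //.
    by apply: (uniq_graded (d := dX)) => // p; case: (posX p).
  by apply: (uniq_graded (d := dY)) => // p; case: (posY p).
- move=> t /mem_tens_idx [p [q [_ _ hx hy]]]; rewrite /le2 !eqxx /=.
  by case: (posX p) => _ -> // _ _; case: (posY q) => _ -> // _ _.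
- move=> [x y] [x' y'] /mem_tens_idx [p [q [_ _ /= hx hy]]].
  move=> /mem_tens_idx [p' [q' [_ _ /= hx' hy']]].
  rewrite /le2 /= => /andP [/and4P [/eqP dx /eqP dy h1 h2] /and4P [_ _ h3 h4]].
  rewrite (degX hx) (degX hx') in dx; rewrite (degY hy) (degY hy') in dy; subst p' q'.
  congr pair.
    by case: (posX p) => _ _ ax _; apply: ax => //; rewrite h1 h3.
  by case: (posY q) => _ _ ay _; apply: ay => //; rewrite h2 h4.
- move=> [x2 y2] [x1 y1] [x3 y3] /mem_tens_idx [p2 [q2 [_ _ /= hx2 hy2]]].
  move=> /mem_tens_idx [p1 [q1 [_ _ /= hx1 hy1]]] /mem_tens_idx [p3 [q3 [_ _ /= hx3 hy3]]].
  rewrite /le2 /= => /and4P [/eqP dx /eqP dy h1 h2] /and4P [/eqP dx' /eqP dy' h3 h4].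
  rewrite dx dx' dy dy' !eqxx /=.
  rewrite (degX hx1) (degX hx2) in dx; rewrite (degY hy1) (degY hy2) in dy.
  rewrite (degX hx2) (degX hx3) in dx'; rewrite (degY hy2) (degY hy3) in dy'.
  subst p1 q1 p2 q2; apply/andP; split.
    by case: (posX p3) => _ _ _ tr; apply: tr h1 h3.
  by case: (posY q3) => _ _ _ tr; apply: tr h2 h4.
Qed.

(** Only the cut at position [p] has a left factor of degree [p], so at most one coproduct term lies
    below [(u, v)], and [mul_adj] decides whether it does. *)
Lemma count_cop_le2 p q x u v : x \in bH n -> u \in bH p -> v \in bK q ->
  p <= n -> q <= n ->
  count (fun t => le2 t (u, v)) (cop x) = (p + q == n) && leX x (mul u v).
Proof.
move=> xn up vq hp hq; rewrite (copE xn) count_map.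
rewrite (eq_in_count (a2 := fun i => (i == p) && ((p + q == n) && leX x (mul u v)))).
  case: (_ && leX _ _).
    under eq_count do rewrite andbT.
    by rewrite -/(pred1 p) count_uniq_mem ?iota_uniq // mem_iota /= add0n ltnS hp.
  by under eq_count do rewrite andbF; rewrite count_pred0.
move=> i; rewrite mem_iota add0n ltnS => /= hi.
rewrite /le2 /= (degX (cutlP xn hi)) (degX up) (degY (cutrP xn hi)) (degY vq).
case: eqP => //= ->.
have -> : (n - p == q) = (p + q == n) by apply/eqP/eqP; lia.
by case: eqP => //= e; rewrite (@mul_adj p q) // e.
Qed.

Lemma kerMat_zeta (k : 'I_(size (bH n))) (l : 'I_(size (tens_idx bH bK n))) :
  let x := nth x0 (bH n) k in
  let t := nth (x0, y0) (tens_idx bH bK n) l in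
  ((kerMat x0 y0 bH bK cop unitK n *m zetamx (x0, y0) le2 (tens_idx bH bK n)) k l
   = ((dX t.1 + dY t.2 == n)%N && (0 < dY t.2)%N && leX x (mul t.1 t.2))%:R)%R.
Proof.
move=> x t; rewrite mxE.
have xn : x \in bH n by apply: mem_nth.
have [uE _ _ _] := tens_idx_poset.
have /mem_tens_idx [p [q [hp hq up vq]]] : t \in tens_idx bH bK n by apply: mem_nth.
rewrite (degX up) (degY vq).
transitivity (\sum_(j < size (tens_idx bH bK n))
    (((count (pred1 (nth (x0, y0) (tens_idx bH bK n) j)) (cop x))%:R *
      (le2 (nth (x0, y0) (tens_idx bH bK n) j) t)%:R) -
     (count (pred1 (nth (x0, y0) (tens_idx bH bK n) j)) [:: (x, unitK)])%:R *
      (le2 (nth (x0, y0) (tens_idx bH bK n) j) t)%:R) : rat)%R.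
  apply: eq_bigr => j _; rewrite !mxE -/x -/t mulrBl; congr (_ - _ * _)%R.
  by rewrite /= addn0 [X in _ = (nat_of_bool X)%:R%R]eq_sym.
have xuE : (x, unitK) \in tens_idx bH bK n.
  by apply/mem_tens_idx; exists n, 0; rewrite leqnn leq0n unitP mem_head.
rewrite sumrB !(sum_count_nth (x0, y0) (fun s => (le2 s t)%:R%R)) //; first last.
- move=> s; rewrite (copE xn) => /mapP [i]; rewrite mem_iota add0n ltnS => /= hi ->.
  apply/mem_tens_idx; exists i, (n - i); rewrite hi leq_subr; split=> //=.
    exact: cutlP xn hi.
  exact: cutrP xn hi.
- by move=> s; rewrite inE => /eqP ->.
rewrite big_seq1 -natr_sum.
have -> : (\sum_(s <- cop x) le2 s t)%N = (p + q == n) && leX x (mul t.1 t.2) :> nat.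
  rewrite -(count_cop_le2 xn up vq hp hq) -sum1_count [RHS]big_mkcond /=.
  by apply: eq_bigr => s _; rewrite -surjective_pairing; case: (le2 s t).
(* The subtracted term can lie below [t] only if [t.2] has degree 0, hence is [unitK]; then
   [mul_unit] turns its condition into that of the coproduct term and the two cancel. This is the
   origin of [0 < dY t.2]. *)
have -> : le2 (x, unitK) t = (p + q == n) && (q == 0) && leX x (mul t.1 t.2).
  have u0 : unitK \in bK 0 by rewrite unitP mem_head.
  rewrite /le2 /= (degX xn) (degX up) (degY u0) (degY vq) eq_sym.
  have [q0|_] := eqVneq q 0; last by rewrite !andbF.
  rewrite q0 in vq *; rewrite addn0 /= andbT; case: eqP => //= pn.
  move: vq; rewrite unitP inE => /eqP ->; rewrite (mul_unit up).
  by case: (posY 0) => _ -> //; rewrite andbT.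
rewrite lt0n; case: (p + q == n); case: (q == 0); case: (leX _ _) => //=;
  by rewrite ?subrr ?subr0.
Qed.

(** The zeta matrix of the tensor basis is invertible, so multiplying by it loses nothing; each
    column of the product either vanishes identically or is the M-coordinate of [h] at some
    [mul u v]. *)
Lemma mem_hopf_kernel (h : 'rV[rat]_(size (bH n))) :
  h \in hopf_kernel x0 y0 bH bK cop unitK n <->
  forall j : 'I_(size (bH n)),
    (exists p q u v, [/\ 0 < q, u \in bH p, v \in bK q & nth x0 (bH n) j = mul u v]) ->
    ((h *m zetamx x0 leX (bH n)) 0 j = 0)%R.
Proof.
have zu := zetamx_unit (x0, y0) tens_idx_poset.
have key (l : 'I_(size (tens_idx bH bK n))) :
    let t := nth (x0, y0) (tens_idx bH bK n) l in
    ((h *m kerMat x0 y0 bH bK cop unitK n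
        *m zetamx (x0, y0) le2 (tens_idx bH bK n)) 0 l
     = ((dX t.1 + dY t.2 == n)%N && (0 < dY t.2)%N)%:R *
       \sum_k h 0 k * (leX (nth x0 (bH n) k) (mul t.1 t.2))%:R)%R.
  move=> t; rewrite -mulmxA mxE mulr_sumr; apply: eq_bigr => k _.
  rewrite kerMat_zeta -/t -andbA.
  case: (dX t.1 + _ == n)%N; case: (0 < _)%N => /=; by rewrite ?mul1r ?mulr0 ?mul0r.
have zcol (j : 'I_(size (bH n))) : ((h *m zetamx x0 leX (bH n)) 0 j
    = \sum_k h 0 k * (leX (nth x0 (bH n) k) (nth x0 (bH n) j))%:R)%R.
  by rewrite mxE; apply: eq_bigr => k _; rewrite !mxE.
rewrite /hopf_kernel memv_ker lfunE /=; split.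
  move=> /eqP h0 j [p [q [u [v [q0 up vq e]]]]].
  have jn : nth x0 (bH n) j \in bH n by apply: mem_nth.
  have pq : p + q = n.
    by rewrite -(degX (mulP up vq)) -e (degX jn).
  have tin : (u, v) \in tens_idx bH bK n.
    by apply/mem_tens_idx; exists p, q; split=> //; lia.
  have lt : index (u, v) (tens_idx bH bK n) < size (tens_idx bH bK n).
    by rewrite index_mem.
  have := key (Ordinal lt); rewrite h0 mul0mx mxE nth_index //=.
  rewrite (degX up) (degY vq) pq eqxx q0 mul1r zcol e => <-; done.
move=> h0; have : (h *m kerMat x0 y0 bH bK cop unitK n
        *m zetamx (x0, y0) le2 (tens_idx bH bK n) = 0)%R.
  apply/rowP => l; rewrite key [RHS]mxE.
  set t := nth _ _ _.
  have /mem_tens_idx [p [q [hp hq up vq]]] : t \in tens_idx bH bK n by apply: mem_nth.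
  rewrite (degX up) (degY vq).
  case: eqP => [pq|]; last by rewrite mul0r.
  case: (posnP q) => [q0|q0]; first by rewrite mul0r.
  have mn := mulP up vq; rewrite pq in mn.
  have lt : index (mul t.1 t.2) (bH n) < size (bH n) by rewrite index_mem.
  have := h0 (Ordinal lt); rewrite zcol /= nth_index // => ->; first by rewrite mulr0.
  by exists p, q, t.1, t.2.
move/(congr1 (mulmxr (invmx (zetamx (x0, y0) le2 (tens_idx bH bK n))))) => /=.
by rewrite mulmxK // mul0mx => ->.
Qed.

Lemma Mvec_row (i : 'I_(size (bH n))) :
  Mvec x0 bH n leX (nth x0 (bH n) i) = row i (mobiusmx x0 leX (bH n)).
Proof. by apply/rowP => j; rewrite !mxE. Qed.

Lemma Mvec_zeta x (j : 'I_(size (bH n))) : x \in bH n ->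
  ((Mvec x0 bH n leX x *m zetamx x0 leX (bH n)) 0 j = (x == nth x0 (bH n) j)%:R)%R.
Proof.
move=> xn; have lt : index x (bH n) < size (bH n) by rewrite index_mem.
have := Mvec_row (Ordinal lt); rewrite /= nth_index // => ->.
rewrite -row_mul mul_mobius_zeta // !mxE.
by case: (posX n) => u _ _ _; rewrite -val_eqE /= -(nth_uniq x0 lt (ltn_ord j) u) nth_index.
Qed.

Lemma Mvec_expand (h : 'rV[rat]_(size (bH n))) :
  (h = \sum_j (h *m zetamx x0 leX (bH n)) 0 j *: Mvec x0 bH n leX (nth x0 (bH n) j))%R.
Proof.
rewrite -{1}[h]mulmx1 -(mul_zeta_mobius x0 (posX n)) mulmxA mulmx_sum_row.
by apply: eq_bigr => j _; rewrite Mvec_row.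
Qed.

Lemma free_Mvec s : uniq s -> {subset s <= bH n} ->
  free [seq Mvec x0 bH n leX x | x <- s].
Proof.
elim: s => [|x s IH] /=; first by rewrite nil_free.
move=> /andP [xs us] sub.
have xn : x \in bH n by apply: sub; rewrite mem_head.
have sub' : {subset s <= bH n} by move=> z zs; apply: sub; rewrite inE zs orbT.
rewrite free_cons IH // andbT; apply/negP => xsp.
have lt : index x (bH n) < size (bH n) by rewrite index_mem.
(* [c] reads off the M-coordinate at [x]: it is 1 on M_x and kills every M_y with [y] in the tail
   [s]. *)
pose c := linfun (mulmxr (col (Ordinal lt) (zetamx x0 leX (bH n)))
                  : 'rV[rat]_(size (bH n)) -> 'M[rat]_(1, 1)).
have cE y : y \in bH n -> c (Mvec x0 bH n leX y) = ((y == x)%:R%:M)%R.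
  move=> yn; apply/matrixP => i j; rewrite !ord1 lfunE /= colE mulmxA -colE [LHS]mxE Mvec_zeta //=.
  by rewrite nth_index // mxE eqxx mulr1n.
have : (<<[seq Mvec x0 bH n leX y | y <- s]>> <= lker c)%VS.
  apply/span_subvP => w /mapP [y ys ->]; rewrite memv_ker cE ?sub' //.
  have [yx|_] := eqVneq y x; first by rewrite -yx ys in xs.
  by rewrite raddf0.
move/subvP/(_ _ xsp); rewrite memv_ker cE // eqxx => /eqP/matrixP/(_ 0%R 0%R).
by rewrite !mxE eqxx => /eqP; rewrite oner_eq0.
Qed.

Lemma hopf_kernel_basis (bad : pred X) :
  {in bH n, forall x, bad x <->
     exists p q u v, [/\ 0 < q, u \in bH p, v \in bK q & x = mul u v]} ->
  basis_of (hopf_kernel x0 y0 bH bK cop unitK n)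
    [seq Mvec x0 bH n leX x | x <- bH n & ~~ bad x].
Proof.
move=> badP; rewrite /basis_of free_Mvec ?andbT; first last.
- by move=> x; rewrite mem_filter => /andP [].
- by rewrite filter_uniq //; case: (posX n).
rewrite eqEsubv; apply/andP; split.
  apply/span_subvP => w /mapP [x]; rewrite mem_filter => /andP [nb xn] ->.
  apply/mem_hopf_kernel => j /badP bj; rewrite Mvec_zeta //.
  by case: eqP => // e; rewrite e bj ?mem_nth in nb.
apply/subvP => h /mem_hopf_kernel h0; rewrite [h]Mvec_expand; apply: memv_suml => j _.
have jn : nth x0 (bH n) j \in bH n by apply: mem_nth.
case bj: (bad (nth x0 (bH n) j)); first by rewrite h0 ?scale0r ?mem0v //; apply/badP.
by apply/memvZ/memv_span/map_f; rewrite mem_filter bj.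
Qed.

Lemma hopf_kernel_basis_dim (bad : pred X) :
  {in bH n, forall x, bad x <->
     exists p q u v, [/\ 0 < q, u \in bH p, v \in bK q & x = mul u v]} ->
  basis_of (hopf_kernel x0 y0 bH bK cop unitK n)
    [seq Mvec x0 bH n leX x | x <- bH n & ~~ bad x] /\
  \dim (hopf_kernel x0 y0 bH bK cop unitK n) + count bad (bH n) = size (bH n).
Proof.
move=> badP; have b := hopf_kernel_basis badP; split=> //.
have /andP [/eqP <- fr] := b.
rewrite (eqP fr) size_map size_filter addnC; exact: count_predC.
Qed.

End Kernel.

(** * The Tamari order *)

(* Entry [j] is the size of the left subtree of the [j]-th node in inorder. *)
Fixpoint lv (t : tree) : seq nat :=
  if t is Node l r then lv l ++ nodes l :: lv r else [::].

Definition lv_ge (s t : tree) : bool :=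
  (nodes s == nodes t) && all (fun j => nth 0 (lv t) j <= nth 0 (lv s) j) (iota 0 (nodes t)).

Lemma size_lv t : size (lv t) = nodes t.
Proof. by elim: t => //= l <- r <-; rewrite size_cat /= addnS. Qed.

Lemma nth_lv_node l r j :
  nth 0 (lv (Node l r)) j =
    if j < nodes l then nth 0 (lv l) j
    else if j == nodes l then nodes l else nth 0 (lv r) (j - (nodes l).+1).
Proof.
rewrite /= nth_cat size_lv; case: ltnP => // lj.
case: eqP => [->|/eqP nj]; first by rewrite subnn.
by have -> : j - nodes l = (j - (nodes l).+1).+1 by lia.
Qed.

Lemma nth_lv_le t j : nth 0 (lv t) j <= j.
Proof.
elim: t j => [|l IHl r IHr] j; first by rewrite nth_nil.
rewrite nth_lv_node; case: ltnP => // lj; case: eqP => [->|_] //.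
by apply: leq_trans (IHr _) _; lia.
Qed.

(** A node [j] and its left subtree occupy an inorder interval ending at [j]; two such intervals are
    nested or disjoint. *)
Lemma lv_laminar t i j : j < nodes t -> j - nth 0 (lv t) j <= i -> i <= j ->
  j - nth 0 (lv t) j <= i - nth 0 (lv t) i.
Proof.
elim: t i j => [|l IHl r IHr] i j //; rewrite !nth_lv_node /= => jn.
case: (ltngtP j (nodes l)) => [jl|jl|->].
- by move=> h1 h2; rewrite (leq_ltn_trans h2 jl); apply: IHl.
- move=> h1 h2; have := nth_lv_le r (j - (nodes l).+1) => h3.
  have ni : (i < nodes l) = false by lia.
  have ni' : (i == nodes l) = false by lia.
  rewrite ni ni'.
  have := nth_lv_le r (i - (nodes l).+1).
  have := @IHr (i - (nodes l).+1) (j - (nodes l).+1) ltac:(lia) ltac:(lia) ltac:(lia).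
  by lia.
- by rewrite subnn.
Qed.

(** An entry equal to its own position marks a node of the left spine, whose left subtree contains
    all earlier nodes; the root is the last such node. This makes the root position readable from
    the vector, which gives [lv_inj]. *)
Lemma lv_top_le l r k : k < nodes (Node l r) -> nth 0 (lv (Node l r)) k = k -> k <= nodes l.
Proof.
rewrite nth_lv_node => kn; case: ltnP => [/ltnW //|lk].
case: eqP => [-> //|/eqP nk]; have := nth_lv_le r (k - (nodes l).+1); lia.
Qed.

Lemma lv_inj : injective lv.
Proof.
elim=> [|a IHa b IHb] [|c d] //.
- by move/(congr1 size); rewrite !size_lv.
- by move/(congr1 size); rewrite !size_lv.
move=> e; have en := congr1 size e; rewrite !size_lv in en.
have top l r : nth 0 (lv (Node l r)) (nodes l) = nodes l.
  by rewrite nth_lv_node ltnn eqxx.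
have le l r l' r' : lv (Node l r) = lv (Node l' r') -> nodes l <= nodes l'.
  move=> e'; apply: (@lv_top_le l' r'); last by rewrite -e' top.
  by rewrite -[nodes (Node l' r')]size_lv -e' size_lv /= ltnS leq_addr.
have eac : nodes a = nodes c by apply/eqP; rewrite eqn_leq (le _ _ _ _ e) (le _ _ _ _ (esym e)).
move/eqP: e; rewrite /= eqseq_cat ?size_lv // eqseq_cons.
by case/and3P=> /eqP /IHa -> _ /eqP /IHb ->.
Qed.

Lemma lv_geP s t :
  reflect (nodes s = nodes t /\ forall j, nth 0 (lv t) j <= nth 0 (lv s) j) (lv_ge s t).
Proof.
apply: (iffP andP) => [[/eqP e /allP h]|[e h]]; split=> //.
- move=> j; case: (ltnP j (nodes t)) => jt; last by rewrite nth_default ?size_lv.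
  by apply: h; rewrite mem_iota.
- exact/eqP.
- by apply/allP => j _; apply: h.
Qed.

Lemma lv_ge_refl t : lv_ge t t.
Proof. by apply/lv_geP. Qed.

Lemma lv_ge_anti s t : lv_ge s t -> lv_ge t s -> s = t.
Proof.
move=> /lv_geP [e h] /lv_geP [_ h']; apply: lv_inj.
apply: (@eq_from_nth _ 0); first by rewrite !size_lv.
by move=> j _; apply/eqP; rewrite eqn_leq h h'.
Qed.

Lemma lv_ge_trans : transitive lv_ge.
Proof.
move=> t s u /lv_geP [e h] /lv_geP [e' h']; apply/lv_geP; split; first by rewrite e.
by move=> j; apply: leq_trans (h' j) (h j).
Qed.

Lemma trees_auxS f n : trees_aux f.+1 n.+1 =
  flatten [seq [seq Node l r | l <- trees_aux f k, r <- trees_aux f (n - k)]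
          | k <- iota 0 n.+1].
Proof. by []. Qed.

Lemma mem_trees_aux f n t : n <= f -> (t \in trees_aux f n) = (nodes t == n).
Proof.
elim: f n t => [|f IH] [|n] t; try by case: t.
rewrite ltnS => nf; rewrite trees_auxS; apply/flatten_mapP/eqP.
  case=> k; rewrite mem_iota add0n ltnS => /= kn /allpairsP [[a b] /= [ha hb ->]] /=.
  move: ha hb; rewrite !IH; [|lia|lia]; lia.
case: t => // l r [e]; exists (nodes l); first by rewrite mem_iota; lia.
apply/allpairsP; exists (l, r); rewrite /= !IH; [|lia|lia].
by split=> //; apply/eqP; lia.
Qed.

Lemma mem_trees n t : (t \in trees n) = (nodes t == n).
Proof. exact: mem_trees_aux. Qed.

Lemma trees_aux_uniq f n : n <= f -> uniq (trees_aux f n).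
Proof.
elim: f n => [|f IH] [|n] //; rewrite ltnS => nf; rewrite trees_auxS.
have : {subset iota 0 n.+1 <= gtn n.+1} by move=> k; rewrite mem_iota.
have := iota_uniq 0 n.+1; elim: (iota 0 n.+1) => // k s IHs.
rewrite map_cons [uniq _]/= [flatten _]/= => /andP [ks us] sub.
have kn : k < n.+1 by apply: (sub k); rewrite mem_head.
have sub' : {subset s <= gtn n.+1} by move=> i si; apply: sub; rewrite inE si orbT.
rewrite cat_uniq IHs // andbT; apply/andP; split.
  by apply: allpairs_uniq => [||[a b] [c d] _ _ /= [-> ->]] //; apply: IH; lia.
apply/hasPn => t /flatten_mapP [j js /allpairsP [[a b] /= [ha _ ->]]].
apply: contra ks => /allpairsP [[c d] /= [hc _ [e _]]].
have jn : j < n.+1 by apply: sub'.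
move: ha hc; rewrite !mem_trees_aux; [|lia|lia]; rewrite e => /eqP ej /eqP ek.
by rewrite -ek ej.
Qed.

Lemma trees_uniq n : uniq (trees n).
Proof. exact: trees_aux_uniq. Qed.

Lemma size_trees_aux f n : n <= f -> size (trees_aux f n) = size (trees n).
Proof.
move=> nf; apply/eqP; rewrite -uniq_size_uniq ?trees_uniq ?trees_aux_uniq //.
by move=> t; rewrite mem_trees mem_trees_aux.
Qed.

Lemma size_treesS n :
  size (trees n.+1) = \sum_(k < n.+1) size (trees k) * size (trees (n - k)).
Proof.
rewrite /trees trees_auxS size_flatten sumnE big_map big_map -[iota _ _]/(index_iota 0 n.+1).
rewrite big_mkord; apply: eq_bigr => k _; rewrite size_allpairs; have kn := ltn_ord k.
by rewrite !size_trees_aux //; lia.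
Qed.

Fixpoint tgraft (s t : tree) : tree :=
  if s is Node l r then Node l (tgraft r t) else t.

Lemma lv_tgraft s t : lv (tgraft s t) = lv s ++ lv t.
Proof. by elim: s => //= l _ r ->; rewrite -catA. Qed.

Lemma nodes_tgraft s t : nodes (tgraft s t) = nodes s + nodes t.
Proof. by rewrite -!size_lv lv_tgraft size_cat. Qed.

(** Rotating [Node (Node a b) r] changes a single entry: that of the old root drops from
    [nodes a + nodes b + 1] to [nodes b]. *)
Lemma rot_lv_ge s t : t \in Defs.rot s -> lv_ge s t /\ t <> s.
Proof.
elim: s t => //= l IHl r IHr t; rewrite !mem_cat => /or3P [].
- case: l {IHl} => [|a b] //; rewrite inE => /eqP ->; split.
    apply/lv_geP; split=> [/=|j]; first by lia.
    rewrite !nth_lv_node /=; case: (ltngtP j (nodes a)) => h1.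
    + by have -> : j < (nodes a + nodes b).+1 by lia.
    + have -> : (j < (nodes a + nodes b).+1) = (j - (nodes a).+1 < nodes b) by lia.
      case: ltnP => h2 //.
      have -> : (j == (nodes a + nodes b).+1) = (j - (nodes a).+1 == nodes b) by lia.
      case: eqP => h3; first by lia.
      by rewrite (_ : j - (nodes a).+1 - (nodes b).+1 = j - (nodes a + nodes b).+2) //; lia.
    + by rewrite h1; have -> : nodes a < (nodes a + nodes b).+1 by lia.
  by move=> [e _]; have := congr1 nodes e => /=; lia.
- case/mapP=> l' /IHl [/lv_geP [e h] ne] ->; split; last by case.
  apply/lv_geP; split=> [/=|j]; first by rewrite e.
  by rewrite !nth_lv_node e; case: ltnP.
- case/mapP=> r' /IHr [/lv_geP [e h] ne] ->; split; last by case.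
  apply/lv_geP; split=> [/=|j]; first by rewrite e.
  by rewrite !nth_lv_node; case: ltnP => // _; case: eqP.
Qed.

Lemma rot_left l l' r : l' \in Defs.rot l -> Node l' r \in Defs.rot (Node l r).
Proof.
by move=> h; rewrite [Defs.rot (Node _ _)]/= !mem_cat (map_f (Node^~ r)) ?orbT.
Qed.

Lemma rot_right l r r' : r' \in Defs.rot r -> Node l r' \in Defs.rot (Node l r).
Proof. by move=> h; rewrite [Defs.rot (Node _ _)]/= !mem_cat map_f ?orbT. Qed.

(** Here [k] is a node of the left spine below the root and [P] is its parent. Rotating that edge
    leaves [P] with the former right subtree of [k] on its left, that is, the [P - k.+1] nodes
    strictly between them. *)
Lemma rot_spine a b k : k < nodes a -> nth 0 (lv (Node a b)) k = k ->
  exists2 t, t \in Defs.rot (Node a b) & exists P,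
    [/\ k < P, P <= nodes a, nodes t = nodes (Node a b) &
     forall j, nth 0 (lv t) j = if j == P then P - k.+1 else nth 0 (lv (Node a b)) j].
Proof.
elim: a b => // a1 IH a2 _ b ka ek.
have ek' : nth 0 (lv (Node a1 a2)) k = k by move: ek; rewrite nth_lv_node ka.
have := lv_top_le ka ek'; rewrite leq_eqVlt => /orP [/eqP ke|kl].
  exists (Node a1 (Node a2 b)); first by rewrite /= mem_head.
  exists (nodes (Node a1 a2)); split=> //; first by rewrite /=; lia.
  move=> j; rewrite !nth_lv_node /=; case: (ltngtP j (nodes a1)) => h1.
  + have -> : j < (nodes a1 + nodes a2).+1 by lia.
    by have -> : (j == (nodes a1 + nodes a2).+1) = false by lia.
  + have -> : (j < (nodes a1 + nodes a2).+1) = (j - (nodes a1).+1 < nodes a2) by lia.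
    have -> : (j == (nodes a1 + nodes a2).+1) = (j - (nodes a1).+1 == nodes a2) by lia.
    case: ltngtP => h2 //; last by lia.
    by rewrite (_ : j - (nodes a1).+1 - (nodes a2).+1 = j - (nodes a1 + nodes a2).+2) //; lia.
  + have -> : j < (nodes a1 + nodes a2).+1 by lia.
    by have -> : (j == (nodes a1 + nodes a2).+1) = false by lia.
have [t tr [P [kP Pa nt lt]]] := IH a2 kl ek'.
exists (Node t b); first exact: rot_left.
exists P; split=> //; first by rewrite /=; lia.
  by move: nt => /= ->.
move=> j; rewrite !(nth_lv_node _ b) nt lt; case: ltnP => // h1.
by have -> : (j == P) = false by move: h1 => /=; lia.
Qed.

(** At the root position [nodes c] of [t] the entry of [s] is forced to its maximal value, so this
    position lies on the left spine of [s]. If it is the root of [s], a rotation is found in one of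
    the subtrees; otherwise the edge above it is rotated. *)
Lemma rot_towards s t : lv_ge s t -> s <> t ->
  exists2 s', s' \in Defs.rot s & lv_ge s' t.
Proof.
elim: s t => [|a IHa b IHb] [|c d] // /lv_geP [e h] ne.
have hc : nth 0 (lv (Node a b)) (nodes c) = nodes c.
  apply/eqP; rewrite eqn_leq nth_lv_le /=; have := h (nodes c).
  by rewrite [nth _ _ _ <= _]/= (nth_lv_node c d) ltnn eqxx.
have lc : nodes c < nodes (Node a b) by rewrite e /=; lia.
have := lv_top_le lc hc; rewrite leq_eqVlt => /orP [/eqP ca|ca].
  have ge1 : lv_ge a c.
    apply/lv_geP; split=> // j; case: (ltnP j (nodes c)) => jc; last first.
      by rewrite nth_default // size_lv.
    by have := h j; rewrite !nth_lv_node -ca jc.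
  have ge2 : lv_ge b d.
    apply/lv_geP; split=> [|j]; first by move: e => /=; lia.
    have := h (j + (nodes c).+1); rewrite !nth_lv_node -ca addnK.
    have -> : (j + (nodes c).+1 < nodes c) = false by lia.
    by have -> : (j + (nodes c).+1 == nodes c) = false by lia.
  have [eac|/eqP nac] := eqVneq a c.
    have [eab|/eqP nbd] := eqVneq b d; first by case: ne; rewrite eac eab.
    have [b' b'r /lv_geP [e' h']] := IHb d ge2 nbd.
    exists (Node a b'); first exact: rot_right.
    apply/lv_geP; split; first by rewrite /= e' ca.
    by move=> j; rewrite !nth_lv_node eac; case: ltngtP.
  have [a' a'r /lv_geP [e' h']] := IHa c ge1 nac.
  exists (Node a' b); first exact: rot_left.
  case/lv_geP: ge2 => e2 h2; apply/lv_geP; split; first by rewrite /= e' e2.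
  by move=> j; rewrite !nth_lv_node e'; case: ltngtP.
have [s' s'r [P [cP Pa ns ls]]] := rot_spine ca hc.
exists s' => //; apply/lv_geP; split; first by rewrite ns.
(* Only the entry at [P] has changed, to [P - (nodes c).+1]. In [t] this position has index
   [P - (nodes c).+1] inside the right subtree [d], and entries never exceed their index. *)
move=> j; rewrite ls; case: eqP => [->|_] //; rewrite nth_lv_node.
have -> : (P < nodes c) = false by lia.
have -> : (P == nodes c) = false by lia.
exact: nth_lv_le.
Qed.

Lemma reach_lv_ge k s t : t \in reach k s -> lv_ge s t.
Proof.
elim: k s => [|k IH] s /=; rewrite inE; first by move/eqP ->; apply: lv_ge_refl.
case/predU1P=> [->|/flatten_mapP [u /rot_lv_ge [su _] /IH]]; first exact: lv_ge_refl.
exact: lv_ge_trans.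
Qed.

(** Each rotation removes at least [s] itself from the finite set of trees above it, so the size of
    that set bounds the length of a path. *)
Lemma lv_ge_reach k s t : count (lv_ge s) (trees (nodes s)) <= k ->
  lv_ge s t -> t \in reach k s.
Proof.
elim: k s => [|k IH] s ck st.
  have : 0 < count (lv_ge s) (trees (nodes s)).
    by rewrite -has_count; apply/hasP; exists s; rewrite ?mem_trees ?lv_ge_refl.
  by rewrite ltnNge ck.
rewrite /= inE; have [->|/eqP nst] := eqVneq t s; rewrite //=.
have [s' s'r s't] := rot_towards st (nesym nst).
have [ss' nss'] := rot_lv_ge s'r.
apply/flatten_mapP; exists s' => //; apply: IH => //.
have /lv_geP [<- _] := ss'; rewrite -ltnS; apply: leq_trans ck.
rewrite -!size_filter.
apply: (@leq_trans (size (s :: [seq u <- trees (nodes s) | lv_ge s' u]))) => //.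
apply: uniq_leq_size => [|u].
  rewrite /= filter_uniq ?trees_uniq // andbT mem_filter; apply/negP => /andP [s's _].
  exact/nss'/lv_ge_anti.
rewrite inE => /predU1P [->|]; rewrite !mem_filter.
  by rewrite lv_ge_refl mem_trees /=.
by move=> /andP [h ->]; rewrite (lv_ge_trans ss' h).
Qed.

Lemma tamari_leE : tamari_le =2 lv_ge.
Proof.
move=> s t; apply/idP/idP; first exact: reach_lv_ge.
by apply: lv_ge_reach; apply: count_size.
Qed.

(** * The kernel of the map from trees to quasi-symmetric functions *)

Lemma count_param (X Z : eqType) n (s : seq X) (bad : pred X)
    (L : nat -> seq Z) (f : nat -> Z -> X) :
  uniq s -> (forall k, uniq (L k)) ->
  (forall k z, k < n -> z \in L k -> f k z \in s) ->
  {in s, forall x, bad x <-> exists k z, [/\ k < n, z \in L k & x = f k z]} ->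
  (forall k k' z z', k < n -> k' < n -> z \in L k -> z' \in L k' ->
     f k z = f k' z' -> k = k' /\ z = z') ->
  count bad s = \sum_(k < n) size (L k).
Proof.
move=> us uL fs badP finj; rewrite -size_filter.
have -> : \sum_(k < n) size (L k) = size [seq f k z | k <- iota 0 n, z <- L k].
  by rewrite size_allpairs_dep sumnE big_map -(big_mkord xpredT (fun k => size (L k))) /index_iota subn0.
apply/eqP; rewrite -uniq_size_uniq ?filter_uniq //; last first.
  move=> x; rewrite mem_filter; apply/idP/idP.
    move=> /allpairsPdep [k [z [/=]]]; rewrite mem_iota => kn zL ->.
    have fin := fs _ _ kn zL; rewrite fin andbT.
    by apply/badP => //; exists k, z.
  move=> /andP [bx xs]; have [k [z [kn zL ->]]] := (badP _ xs).1 bx.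
  by apply/allpairsPdep; exists k, z; rewrite mem_iota.
apply: allpairs_uniq_dep => //; first exact: iota_uniq.
move=> _ _ /allpairsPdep [k [z [h1 h2 ->]]] /allpairsPdep [k' [z' [h3 h4 ->]]] /= e.
by rewrite !mem_iota in h1 h3; case: (finj k k' z z') => // -> ->.
Qed.

Lemma size_split_tree t : size (split_tree t) = (nodes t).+1.
Proof. by elim: t => //= l IHl r IHr; rewrite size_cat !size_map IHl IHr; lia. Qed.

Definition tcut (p : nat) (t : tree) : tree * tree :=
  nth (Leaf, Leaf) (split_tree t) p.

Lemma tcut_node p l r : p <= nodes (Node l r) ->
  tcut p (Node l r) =
    if p <= nodes l then ((tcut p l).1, Node (tcut p l).2 r)
    else (Node l (tcut (p - (nodes l).+1) r).1, (tcut (p - (nodes l).+1) r).2).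
Proof.
move=> pn; rewrite /tcut /= nth_cat size_map size_split_tree ltnS.
case: leqP => pl; first by rewrite (nth_map (Leaf, Leaf)) // size_split_tree.
by rewrite (nth_map (Leaf, Leaf)) // size_split_tree; move: pn => /=; lia.
Qed.

(** Node [p + j] keeps on the right side only the left descendants at position [p] or later. They
    form an interval ending just before [p + j], so at most [j] survive: hence the minimum. *)
Lemma tcutP p t : p <= nodes t ->
  [/\ lv (tcut p t).1 = take p (lv t), nodes (tcut p t).2 = nodes t - p &
      forall j, nth 0 (lv (tcut p t).2) j = minn j (nth 0 (lv t) (p + j))].
Proof.
elim: t p => [|l IHl r IHr] p pn.
  by case: p pn => // _; split=> // j; rewrite !nth_nil minn0.
rewrite tcut_node //; case: leqP => pl /=.
  have [h1 h2 h3] := IHl _ pl; split.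
  - by rewrite h1 take_cat size_lv; case: ltngtP pl => // ->; rewrite subnn take0 take_oversize ?size_lv ?cats0.
  - by rewrite h2; lia.
  - move=> j; rewrite (nth_lv_node (tcut p l).2 r) (nth_lv_node l r) h2 h3.
    have -> : (j < nodes l - p) = (p + j < nodes l) by lia.
    case: ltnP => // plj; have -> : (j == nodes l - p) = (p + j == nodes l) by lia.
    case: eqP => [e|/eqP ne]; first by lia.
    have := nth_lv_le r (j - (nodes l - p).+1).
    have -> : j - (nodes l - p).+1 = p + j - (nodes l).+1 by lia.
    lia.
have pr : p - (nodes l).+1 <= nodes r by move: pn => /=; lia.
have [h1 h2 h3] := IHr _ pr; split.
- rewrite h1 take_cat size_lv; have -> : (p < nodes l) = false by lia.
  by have -> : p - nodes l = (p - (nodes l).+1).+1 by lia.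
- by rewrite h2; lia.
- move=> j; rewrite h3 (nth_lv_node l r).
  have -> : (p + j < nodes l) = false by lia.
  have -> : (p + j == nodes l) = false by lia.
  by have -> : p + j - (nodes l).+1 = p - (nodes l).+1 + j by lia.
Qed.

(** The minimum in [tcutP] does not disturb the comparison with [w], whose entries never exceed
    their index either. *)
Lemma lv_ge_tgraft p x u w : nodes u = p -> nodes x = p + nodes w ->
  lv_ge x (tgraft u w) = lv_ge (tcut p x).1 u && lv_ge (tcut p x).2 w.
Proof.
move=> up xn; have px : p <= nodes x by rewrite xn leq_addr.
have [h1 h2 h3] := tcutP px.
have n1 : nodes (tcut p x).1 = p by rewrite -size_lv h1 size_takel ?size_lv.
have n2 : nodes (tcut p x).2 = nodes w by rewrite h2 xn addKn.
apply/lv_geP/andP.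
  case=> _ h; split; apply/lv_geP; split; rewrite ?n1 ?n2 //.
    move=> j; case: (ltnP j p) => jp; last by rewrite nth_default // size_lv up.
    by have := h j; rewrite h1 nth_take // lv_tgraft nth_cat size_lv up jp.
  move=> j; rewrite h3 leq_min nth_lv_le; have := h (p + j).
  by rewrite lv_tgraft nth_cat size_lv up ltnNge leq_addr /= addKn.
case=> /lv_geP [_ g1] /lv_geP [_ g2]; split; first by rewrite nodes_tgraft up.
move=> j; rewrite lv_tgraft nth_cat size_lv up; case: ltnP => jp.
  by have := g1 j; rewrite h1 nth_take.
by have := g2 (j - p); rewrite h3 leq_min subnKC // => /andP [].
Qed.

(** * Grafts of right combs and the descent map *)

(** Puts a new root with empty right subtree on top of the last progressive component, so a final
    right comb gets one node longer. *)
Fixpoint grow (t : tree) : tree :=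
  match t with
  | Leaf => Node Leaf Leaf
  | Node l Leaf => Node (Node l Leaf) Leaf
  | Node l r => Node l (grow r)
  end.

(* The Tamari-largest tree with [m] nodes whose set [L] is [S]:
   a graft of right combs, cut at the elements of [S]. *)
Fixpoint combs (m : nat) (S : seq nat) : tree :=
  if m is m'.+1 then
    if m' \in S then tgraft (combs m' S) (Node Leaf Leaf) else grow (combs m' S)
  else Leaf.

Lemma grow_node l r : r != Leaf -> grow (Node l r) = Node l (grow r).
Proof. by case: r. Qed.

Lemma last_comp_node l r : r != Leaf -> last_comp_tree (Node l r) = last_comp_tree r.
Proof. by case: r. Qed.

Lemma lv_grow t : t != Leaf -> lv (grow t) = rcons (lv t) (last 0 (lv t)).+1.
Proof.
elim: t => // l _ r IHr _; case: (eqVneq r Leaf) => [->|nr].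
  by rewrite /= last_cat /= cats1 addn0.
rewrite grow_node //= IHr // -rcons_cons -rcons_cat last_cat /=.
by case: r nr {IHr} => //= a b _; rewrite !last_cat.
Qed.

Lemma nodes_grow t : nodes (grow t) = (nodes t).+1.
Proof.
have [->|nt] := eqVneq t Leaf; first by [].
by rewrite -!size_lv lv_grow // size_rcons.
Qed.

Lemma last_comp_grow t : t != Leaf -> last_comp_tree (grow t) = Node (last_comp_tree t) Leaf.
Proof.
elim: t => // l _ r IHr _; case: (eqVneq r Leaf) => [-> //|nr].
rewrite grow_node // last_comp_node; last by case: r nr {IHr} => // a [|c d].
by rewrite last_comp_node // IHr.
Qed.

Lemma last_comp_tgraft u w : w != Leaf -> last_comp_tree (tgraft u w) = last_comp_tree w.
Proof.
move=> nw; elim: u => // l _ r IHr; rewrite [tgraft _ _]/= last_comp_node //.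
by case: r {IHr}.
Qed.

Lemma nodes_combs m S : nodes (combs m S) = m.
Proof.
elim: m => //= m IH; case: ifP => _; last by rewrite nodes_grow IH.
by rewrite nodes_tgraft IH addn1.
Qed.

Lemma combs_neq_Leaf m S : 0 < m -> combs m S != Leaf.
Proof. by move=> m0; apply/eqP => /(congr1 nodes); rewrite nodes_combs => e; rewrite e in m0. Qed.

Lemma lv_combsS m S : lv (combs m.+1 S) =
  rcons (lv (combs m S))
    (if (m == 0) || (m \in S) then 0 else (nth 0 (lv (combs m S)) m.-1).+1).
Proof.
rewrite [combs _ _]/= -/(combs m S); case: (posnP m) => [->|m0] /=.
  by case: ifP.
case: ifP => mS; first by rewrite lv_tgraft cats1.
by rewrite lv_grow ?combs_neq_Leaf // -nth_last size_lv nodes_combs.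
Qed.

Lemma nth_lv_combs m S i : i.+1 < m ->
  nth 0 (lv (combs m S)) i.+1 =
    if i.+1 \in S then 0 else (nth 0 (lv (combs m S)) i).+1.
Proof.
elim: m => // m IH; rewrite ltnS leq_eqVlt lv_combsS !nth_rcons size_lv nodes_combs.
case/orP=> [/eqP <-|im]; first by rewrite ltnn eqxx /= ltnSn.
by rewrite im (ltnW im) IH.
Qed.

(** Leaf [i] comes just before node [i] in inorder and is its left child exactly when that node has
    an empty left subtree. The last leaf precedes no node and is a right child, unless it is the
    whole tree. *)
Lemma nth_leaf_flags t b i : i <= nodes t ->
  nth false (leaf_flags t b) i =
    if t == Leaf then b else (i < nodes t) && (nth 0 (lv t) i == 0).
Proof.
have sz t' b' : size (leaf_flags t' b') = (nodes t').+1.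
  by elim: t' b' => //= l IHl r IHr b'; rewrite size_cat IHl IHr; lia.
elim: t b i => [|l IHl r IHr] b i; first by case: i.
move=> il; rewrite nth_lv_node [leaf_flags _ _]/= nth_cat sz ltnS.
have -> : (Node l r == Leaf) = false by [].
move: il; rewrite [nodes (Node l r)]/= => il.
case: (leqP i (nodes l)) => [h|h].
  rewrite IHl //; have -> : i < (nodes l + nodes r).+1 by lia.
  case: eqP => [el|/eqP nl]; first by move: h; rewrite el leqn0 => /eqP ->.
  case: ltngtP h => // -> _ /=; by case: (l) nl.
have -> : (i < nodes l) = false by lia.
have -> : (i == nodes l) = false by lia.
rewrite IHr; last by lia.
have -> : (i < (nodes l + nodes r).+1) = (i - (nodes l).+1 < nodes r) by lia.
by case: eqP => // ->; rewrite ltn0.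
Qed.

Lemma mem_Ldes t i : (i \in Ldes t) = (0 < i < nodes t) && (nth 0 (lv t) i == 0).
Proof.
rewrite mem_filter mem_iota.
case: (posnP (nodes t)) => [e|tn]; first by rewrite e /=; lia.
have -> : (1 <= i < 1 + (nodes t).-1) = (0 < i < nodes t) by lia.
case h: (0 < i < nodes t); rewrite ?andbF ?andbT //=.
rewrite nth_leaf_flags; last by lia.
have -> : (t == Leaf) = false by case: (t) tn.
by case/andP: h => _ ->.
Qed.

(** A nonzero entry at [j.+1] means that its interval contains [j]; by laminarity it is then at
    least one more than entry [j]. The vector of [combs m S] attains equality at every positive
    position outside [S], so it is the smallest vector with nonzero entries there. *)
Lemma lv_ge_combs m S t : nodes t = m ->
  lv_ge t (combs m S) = all (mem S) (Ldes t).
Proof.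
move=> tm; apply/lv_geP/allP.
  case=> _ h i; rewrite mem_Ldes => /andP [/andP [i0 im] /eqP z]; apply/negPn/negP => niS.
  case: i i0 im z niS => // i _ im z niS; have := h i.+1.
  by rewrite nth_lv_combs -?tm // (negPf (niS : i.+1 \notin S)) tm z.
move=> h; split=> [|j]; first by rewrite nodes_combs.
elim: j => [|j IH]; first by apply: leq_trans (nth_lv_le _ _) _.
case: (ltnP j.+1 m) => jm; last by rewrite nth_default ?size_lv ?nodes_combs.
rewrite nth_lv_combs //; case: ifP => // njS.
have nz : nth 0 (lv t) j.+1 != 0.
  apply/negP => z; have := h j.+1; rewrite mem_Ldes tm jm z => /(_ isT).
  by rewrite inE njS.
apply: leq_ltn_trans IH _; have := @lv_laminar t j j.+1; rewrite tm jm.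
have := nth_lv_le t j; have := nth_lv_le t j.+1.
move: nz; lia.
Qed.

Lemma filter_powerlist a s : filter a s \in powerlist s.
Proof.
elim: s => //= x s IH; rewrite mem_cat; case: (a x); last by rewrite IH orbT.
by rewrite map_f.
Qed.

Lemma powerlist_subseq u s : u \in powerlist s -> subseq u s.
Proof.
elim: s u => [|x s IH] u /=; first by rewrite inE => /eqP ->.
rewrite mem_cat => /orP [/mapP [v /IH vs ->]|/IH us]; first by rewrite /= eqxx.
exact: subseq_trans us (subseq_cons _ _).
Qed.

Lemma powerlist_uniq s : uniq s -> uniq (powerlist s).
Proof.
elim: s => //= x s IH /andP [xs us]; rewrite cat_uniq map_inj_uniq ?IH //; last by move=> ? ? [].
rewrite andbT /=; apply/hasPn => u /powerlist_subseq us'.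
apply/negP => /mapP [v _ e]; case/negP: xs.
by apply: (mem_subseq us'); rewrite e mem_head.
Qed.

Lemma qsym_basis_poset p : poset_on (qsym_basis p) (fun a b => all (mem b.2) a.2).
Proof.
split.
- by rewrite map_inj_uniq ?powerlist_uniq ?iota_uniq // => ? ? [].
- by move=> [m S] _ /=; apply/allP.
- move=> _ _ /mapP [S hS ->] /mapP [S' hS' ->] /= /andP [/allP h1 /allP h2].
  have u := iota_uniq 1 p.-1.
  rewrite (subseq_uniqP u (powerlist_subseq hS)) (subseq_uniqP u (powerlist_subseq hS')).
  congr (_, _); apply: eq_filter => i; apply/idP/idP; [exact: h1|exact: h2].
- move=> b a c _ _ _ /allP h1 /allP h2; apply/allP => i /h1; exact: h2.
Qed.

Lemma trees_poset p : poset_on (trees p) tamari_le.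
Proof.
split; first exact: trees_uniq.
- by move=> t _; rewrite tamari_leE lv_ge_refl.
- by move=> s t _ _; rewrite !tamari_leE => /andP []; apply: lv_ge_anti.
- by move=> t s u _ _ _; rewrite !tamari_leE; apply: lv_ge_trans.
Qed.

Lemma nodes_tcutl p t : p <= nodes t -> nodes (tcut p t).1 = p.
Proof. by move=> pt; have [h _ _] := tcutP pt; rewrite -size_lv h size_takel ?size_lv. Qed.

Lemma is_comb_last_combs m S : is_comb (last_comp_tree (combs m S)).
Proof.
elim: m => //= m IH; case: ifP => _; first by rewrite last_comp_tgraft.
case: (posnP m) => [-> //|m0]; by rewrite last_comp_grow ?combs_neq_Leaf //= IH.
Qed.

Lemma combs0E t : is_comb t -> t = combs (nodes t) [::].
Proof.
elim: t => //= l IHl r _ /andP [/eqP -> cl]; rewrite addn0 -(IHl cl).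
by case: l cl {IHl} => //= a b /andP [/eqP -> _].
Qed.

Lemma last_comp_is_combP t : t != Leaf ->
  is_comb (last_comp_tree t) <->
  exists u m, 0 < m /\ t = tgraft u (combs m [::]).
Proof.
move=> nt; split; last first.
  case=> u [m [m0 ->]]; rewrite last_comp_tgraft ?combs_neq_Leaf //.
  exact: is_comb_last_combs.
elim: t nt => // l _ r IHr _; case: (eqVneq r Leaf) => [->|nr].
  rewrite [last_comp_tree _]/= => h; exists Leaf, (nodes (Node l Leaf)).
  by split=> //; apply: combs0E.
rewrite last_comp_node // => /(IHr nr) [u [m [m0 ->]]].
by exists (Node l u), m.
Qed.

Lemma lv_combs0 m : lv (combs m [::]) = iota 0 m.
Proof.
elim: m => // m IH; have -> : iota 0 m.+1 = rcons (iota 0 m) m by rewrite -addn1 iotaD cats1.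
rewrite lv_combsS IH orbF; congr rcons.
by case: m {IH} => // m; rewrite nth_iota.
Qed.

(** Whatever the set, [combs q S] with [0 < q] ends in a right comb. Conversely a final right comb
    is itself [combs] of the empty set, so the empty set serves as witness. *)
Lemma last_comp_comb_mul n : 0 < n ->
  {in trees n, forall t, is_comb (last_comp_tree t) <->
     exists p q u v, [/\ 0 < q, u \in trees p, v \in qsym_basis q
                       & t = tgraft u (combs v.1 v.2)]}.
Proof.
move=> n0 t; rewrite mem_trees => /eqP tn.
have nt : t != Leaf by apply/eqP => e; rewrite -tn e in n0.
split.
  case/(last_comp_is_combP nt) => u [m [m0 ->]].
  exists (nodes u), m, u, (m, [::]); split; rewrite ?mem_trees //.
  by apply/map_f; elim: (iota _ _) => //= x s IH; rewrite mem_cat IH orbT.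
case=> p [q [u [v [q0 _ /mapP [S _ ->] ->]]]] /=.
by rewrite last_comp_tgraft ?is_comb_last_combs // combs_neq_Leaf.
Qed.

Lemma count_last_comb n : 0 < n ->
  count (fun t => is_comb (last_comp_tree t)) (trees n) = \sum_(k < n) size (trees k).
Proof.
move=> n0; apply: (@count_param _ _ _ _ _ _ (fun k u => tgraft u (combs (n - k) [::]))).
- exact: trees_uniq.
- exact: trees_uniq.
- move=> k u kn; rewrite !mem_trees nodes_tgraft nodes_combs => /eqP ->.
  by apply/eqP; lia.
- move=> t; rewrite mem_trees => /eqP tn.
  have nt : t != Leaf by apply/eqP => e; rewrite -tn e in n0.
  rewrite last_comp_is_combP //; split.
    case=> u [m [m0 e]]; have := congr1 nodes e; rewrite nodes_tgraft nodes_combs tn => en.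
    exists (nodes u), u; rewrite mem_trees eqxx; split=> //; first by lia.
    by rewrite e; congr tgraft; congr combs; lia.
  by case=> k [u [kn _ ->]]; exists u, (n - k); rewrite subn_gt0.
- move=> k k' u u' kn kn' _ _ e.
  have := congr1 lv e; rewrite !lv_tgraft !lv_combs0 => e1.
  (* The right comb with m nodes has vector 0, 1, ..., m-1, so the last entry of the graft
     determines [n - k]. *)
  have lst w m : 0 < m -> last 0 (w ++ iota 0 m) = m.-1.
    by move=> m0; rewrite last_cat -nth_last size_iota nth_iota ?add0n //; lia.
  have := congr1 (last 0) e1; rewrite !lst ?subn_gt0 // => e2.
  have ek : k = k' by lia.
  split=> //; rewrite ek in e1.
  have sz : size (lv u) = size (lv u') by have := congr1 size e1; rewrite !size_cat => /addIn.
  move/eqP: e1; rewrite eqseq_cat //.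
  by case/andP=> /eqP /lv_inj.
Qed.

Lemma B_kernel_basis_dim n : 0 < n ->
  basis_of (B_kernel n) [seq MY n t | t <- trees n & ~~ is_comb (last_comp_tree t)] /\
  \dim (B_kernel n) + \sum_(k < n) size (trees k) = size (trees n).
Proof.
move=> n0; rewrite -(count_last_comb n0).
apply: (@hopf_kernel_basis_dim _ _ Leaf (0, [::]) trees qsym_basis copY (0, [::])
  nodes fst tamari_le (fun a b => all (mem b.2) a.2)
  (fun p t => (tcut p t).1) (fun p t => (nodes (tcut p t).2, Ldes (tcut p t).2))
  (fun u v => tgraft u (combs v.1 v.2))).
- exact: trees_poset.
- exact: qsym_basis_poset.
- by move=> p t; rewrite mem_trees => /eqP.
- by move=> p v /mapP [S _ ->].
- move=> m t; rewrite mem_trees => /eqP tm; rewrite /copY -tm -size_split_tree.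
  by rewrite -{1}(mkseq_nth (Leaf, Leaf) (split_tree t)) /mkseq -map_comp.
- by move=> m p t; rewrite !mem_trees => /eqP <- /nodes_tcutl ->.
- move=> m p t; rewrite mem_trees => /eqP <- pt.
  have [_ -> _] := tcutP pt.
  by apply: map_f; have [_ <- _] := tcutP pt; apply: filter_powerlist.
- move=> p q u v; rewrite !mem_trees => /eqP <- /mapP [S _ ->] /=.
  by rewrite nodes_tgraft nodes_combs.
- move=> p q x u v; rewrite !mem_trees => /eqP xn /eqP up /mapP [S _ ->] /=.
  rewrite !tamari_leE (@lv_ge_tgraft p) ?nodes_combs // lv_ge_combs //.
  have px : p <= nodes x by rewrite xn leq_addr.
  by have [_ -> _] := tcutP px; rewrite xn addKn.
- by [].
- by move=> p u _ /=; elim: u => //= l _ r ->.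
- exact: last_comp_comb_mul.
Qed.

(** * Catalan numbers *)

Section CatalanSeries.
Local Open Scope ring_scope.

(* The coefficient of [x^n] in the [k]-th power of the Catalan series. *)
Definition ballot (n k : nat) : int :=
  if n is m.+1 then
    'C((m.*2 + k).+1, m.+1)%:R - 'C((m.*2 + k).+1, m)%:R
  else 1.

Lemma ballot0 n : ballot n.+1 0 = 0.
Proof.
rewrite /ballot addn0 -(@bin_sub n.*2.+1 n); last by lia.
by rewrite (_ : (n.*2.+1 - n)%N = n.+1) ?subrr //; lia.
Qed.

(** Coefficient form of C^(k+1) = C^k + x C^(k+2), which comes from C = 1 + x C^2; on the binomial
    side it is Pascal's rule. *)
Lemma ballotS n k : ballot n.+1 k.+1 = ballot n.+1 k + ballot n k.+2.
Proof.
case: n => [|n] /=; first by rewrite !bin1 !bin0; lia.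
rewrite !doubleS !addnS !addSn [in LHS]binS ['C(_.+4, n.+1)]binS !natrD; lia.
Qed.

(** A polynomial stands in for the Catalan series; its functional equation is available only up to
    degree [N], hence the bounds [n <= N] below. *)
Definition catalan_poly (N : nat) : {poly int} :=
  \poly_(i < N.+1) (size (trees i))%:R.

Lemma catalan_poly_eq N n : (n <= N)%N ->
  (catalan_poly N - 1 - 'X * catalan_poly N ^+ 2)`_n = 0.
Proof.
move=> nN; rewrite !coefB coefXM coef1 /catalan_poly coef_poly ltnS nN.
case: n nN => [|n] nN /=; first by rewrite subr0 subrr.
rewrite subr0 expr2 coefM size_treesS natr_sum -sumrB big1 // => i _.
have := ltn_ord i; rewrite ltnS => ilt.
rewrite !coef_poly !ltnS (leq_trans ilt (ltnW nN)) natrM.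
by rewrite (leq_trans (leq_subr _ _) (ltnW nN)) subrr.
Qed.

Lemma coef_catalan_exp N n k : (n <= N)%N -> (catalan_poly N ^+ k)`_n = ballot n k.
Proof.
elim: n k => [|n IHn] k nN.
  elim: k => [|k IHk]; first by rewrite expr0 coef1.
  by rewrite exprS coef0M IHk /catalan_poly coef_poly.
elim: k => [|k IHk]; first by rewrite expr0 coef1 ballot0.
rewrite ballotS -IHk -(IHn k.+2 (ltnW nN)); apply/eqP; rewrite -subr_eq0.
set P := catalan_poly N.
have : (P ^+ k * (P - 1 - 'X * P ^+ 2))`_n.+1 = 0.
  rewrite coefM big1 // => i _; rewrite catalan_poly_eq ?mulr0 //.
  exact: leq_trans (leq_subr _ _) nN.
have -> : P ^+ k * (P - 1 - 'X * P ^+ 2) = P ^+ k.+1 - P ^+ k - 'X * P ^+ k.+2.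
  by rewrite !exprS expr0; ring.
by rewrite !coefB coefXM /= opprD addrA => ->.
Qed.

Lemma size_trees n : size (trees n) = catalan n.
Proof.
have := coef_catalan_exp 1 (leqnn n); rewrite expr1 /catalan_poly coef_poly ltnSn.
case: n => [|n] //= e.
set A := 'C(_, n.+1) in e; set B := 'C(_, n) in e.
have hA : (A * (n.+1`! * n.+1`!))%N = (n.+1).*2`!.
  rewrite -(@bin_fact (n.+1).*2 n.+1); last by lia.
  rewrite /A (_ : (n.*2 + 1).+1 = (n.+1).*2); last by lia.
  by rewrite (_ : ((n.+1).*2 - n.+1)%N = n.+1) //; lia.
have hB : (B * (n`! * n.+2`!))%N = (n.+1).*2`!.
  rewrite -(@bin_fact (n.+1).*2 n); last by lia.
  rewrite /B (_ : (n.*2 + 1).+1 = (n.+1).*2); last by lia.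
  by rewrite (_ : ((n.+1).*2 - n)%N = n.+2) //; lia.
have e' : (size (trees n.+1) + B = A)%N by lia.
rewrite /catalan -(@mulnK (size (trees n.+1)) (n.+1`! * n.+2`!)); last by rewrite muln_gt0 !fact_gt0.
(* With F = (2n+2)!, multiplying by (n+1)! (n+2)! turns [A] into (n+2) F and [B] into (n+1) F, so
   the difference becomes F. *)
congr divn; move: hA hB; rewrite -e' (factS n.+1) (factS n).
move: (n`!) (size _) (_`!) => f c F hA hB; nia.
Qed.

End CatalanSeries.

(** * The kernel of the map from permutations to trees *)

Lemma mem_perms n s : (s \in perms n) = perm_eq s (iota 1 n).
Proof. exact: mem_permutations. Qed.

Lemma perms_size n s : s \in perms n -> size s = n.
Proof. by rewrite mem_perms => /perm_size ->; rewrite size_iota. Qed.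

Lemma perms_uniq n s : s \in perms n -> uniq s.
Proof. by rewrite mem_perms => /perm_uniq ->; rewrite iota_uniq. Qed.

Lemma perms_mem n s x : s \in perms n -> (x \in s) = (0 < x <= n).
Proof. by rewrite mem_perms => /perm_mem ->; rewrite mem_iota add1n ltnS. Qed.

Lemma perms_nth n s i : s \in perms n -> i < n -> 0 < nth 0 s i <= n.
Proof. by move=> sn lt; rewrite -(perms_mem _ sn) mem_nth // (perms_size sn). Qed.

Lemma size_st s : size (st s) = size s.
Proof. by rewrite size_map. Qed.

Lemma rank_lt (s : seq nat) x y : x \in s ->
  (count (fun z => z < x) s < count (fun z => z < y) s) = (x < y).
Proof.
move=> xs; case: (ltnP x y) => xy; last first.
  apply/negbTE; rewrite -leqNgt; apply: sub_count => z /= zy; exact: leq_trans zy xy.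
have -> : count (fun z => z < y) s =
    count (fun z => z < x) s + count (fun z => x <= z < y) s.
  elim: s {xs} => //= z s ->; have [h|h] := ltnP z x; last by lia.
  by rewrite (ltn_trans h xy); lia.
rewrite -[X in X < _]addn0 ltn_add2l -has_count; apply/hasP.
by exists x; rewrite // leqnn xy.
Qed.

Lemma st_lt s i j : i < size s -> j < size s ->
  (nth 0 (st s) i < nth 0 (st s) j) = (nth 0 s i < nth 0 s j).
Proof. by move=> ilt jlt; rewrite !(nth_map 0) // ltnS rank_lt // mem_nth. Qed.

Lemma st_perms s : uniq s -> st s \in perms (size s).
Proof.
move=> us; have u : uniq (st s).
  rewrite map_inj_in_uniq // => x y xs ys [e].
  case: (ltngtP x y) => //.
    by rewrite -(@rank_lt s x y) // e ltnn.
  by rewrite -(@rank_lt s y x) // e ltnn.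
have sub : {subset st s <= iota 1 (size s)}.
  move=> z /mapP [x xs ->]; rewrite mem_iota add1n ltnS -(count_predC (fun y => y < x) s).
  rewrite -[X in X < _]addn0 ltn_add2l -has_count; apply/hasP.
  by exists x => //=; rewrite ltnn.
have [|_ e] := uniq_min_size u sub; first by rewrite size_iota size_st.
by rewrite mem_perms; apply: uniq_perm => //; apply: iota_uniq.
Qed.

Lemma st_id n s : s \in perms n -> st s = s.
Proof.
move=> sn; rewrite /st -[RHS]map_id; apply/eq_in_map => x.
rewrite (perms_mem _ sn) => /andP [x0 xn].
move: sn; rewrite mem_perms => /permP ->.
have -> : iota 1 n = iota 1 x.-1 ++ iota x (n - x.-1).
  have := iotaD 1 x.-1 (n - x.-1); rewrite add1n prednK // subnKC //; lia.
rewrite count_cat (eq_in_count (a2 := predT)); last by move=> y; rewrite mem_iota /=; lia.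
rewrite count_predT size_iota (eq_in_count (a2 := pred0)); last by move=> y; rewrite mem_iota /=; lia.
by rewrite count_pred0; lia.
Qed.

Lemma perms_ext n s t : s \in perms n -> t \in perms n ->
  (forall i j, i < n -> j < n -> (nth 0 s i < nth 0 s j) = (nth 0 t i < nth 0 t j)) ->
  s = t.
Proof.
move=> sn tn h; rewrite -(st_id sn) -(st_id tn).
have ss := perms_size sn; have st := perms_size tn.
apply: (@eq_from_nth _ 0); first by rewrite !size_st ss st.
rewrite size_st ss => i ilt; rewrite !(nth_map 0) ?ss ?st //; congr S.
have cnt r : size r = n -> count (fun y => y < nth 0 r i) r
    = count (fun j => nth 0 r j < nth 0 r i) (iota 0 n).
  by move=> rn; rewrite -{2}(mkseq_nth 0 r) count_map rn.
rewrite !cnt //; apply: eq_in_count => j; rewrite mem_iota => /= jn; exact: h.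
Qed.

Lemma weak_leP n s t : size s = n -> size t = n ->
  reflect (forall i j, i < j -> j < n -> nth 0 s j < nth 0 s i -> nth 0 t j < nth 0 t i)
          (weak_le s t).
Proof.
have inv r i j : ((i, j) \in inv_set r) = (i < j < size r) && (nth 0 r j < nth 0 r i).
  rewrite mem_filter /=.
  have -> : ((i, j) \in [seq (i, j) | i <- iota 0 (size r), j <- iota 0 (size r)])
      = (i < size r) && (j < size r).
    apply/allpairsP/andP => [[[a b] /= []]|[h1 h2]]; first by rewrite !mem_iota => h1 h2 [-> ->].
    by exists (i, j); rewrite !mem_iota.
  case: (ltnP i j) => //= ij; case: (ltnP j (size r)) => jr; rewrite ?andbF //= andbT.
  by rewrite (ltn_trans ij jr) andbT.
move=> sn tn; apply: (iffP allP) => [h i j ij jn lt|h [i j]].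
  by have := h (i, j); rewrite /= !inv ij sn tn jn lt => /(_ isT) /andP [].
by rewrite /= !inv sn tn => /andP [/andP [ij jn] lt]; rewrite ij jn h.
Qed.

Lemma weak_le_refl s : weak_le s s.
Proof. exact/allP. Qed.

Lemma weak_le_trans : transitive weak_le.
Proof. by move=> t s u /allP h1 /allP h2; apply/allP => x /h1; apply: h2. Qed.

Lemma perms_ltNge n s i j : s \in perms n -> i < n -> j < n -> i != j ->
  (nth 0 s i < nth 0 s j) = ~~ (nth 0 s j < nth 0 s i).
Proof.
move=> sn ilt jlt ij; rewrite -leqNgt ltn_neqAle nth_uniq ?(perms_size sn) ?(perms_uniq sn) //.
by rewrite ij.
Qed.

Lemma weak_le_anti n s t : s \in perms n -> t \in perms n ->
  weak_le s t -> weak_le t s -> s = t.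
Proof.
move=> sn tn /(weak_leP (perms_size sn) (perms_size tn)) h1.
move=> /(weak_leP (perms_size tn) (perms_size sn)) h2; apply: (perms_ext sn tn) => i j ilt jlt.
have k a b : a < b -> b < n -> (nth 0 s b < nth 0 s a) = (nth 0 t b < nth 0 t a).
  by move=> ab bn; apply/idP/idP; [apply: h1|apply: h2].
case: (ltngtP i j) => ij; last by rewrite ij !ltnn.
  have nij : i != j by rewrite ltn_eqF.
  by rewrite (perms_ltNge sn) // (perms_ltNge tn) // k.
exact: k.
Qed.

Lemma perms_poset p : poset_on (perms p) weak_le.
Proof.
split; first exact: permutations_uniq.
- by move=> s _; apply: weak_le_refl.
- by move=> s t sp tp /andP []; apply: weak_le_anti sp tp.
- by move=> t s u _ _ _; apply: weak_le_trans.
Qed.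

(** * Grafting of permutations and the section [gam] of [lam] *)

Definition pgraft (u v : seq nat) : seq nat := [seq size v + x | x <- u] ++ v.

Lemma pgraft_perms p q u v : u \in perms p -> v \in perms q -> pgraft u v \in perms (p + q).
Proof.
move=> up vq; rewrite mem_perms addnC iotaD perm_sym perm_catC perm_sym /pgraft (perms_size vq).
rewrite [1 + q]addnC iotaDl; apply: perm_cat; last by rewrite -mem_perms.
by apply: perm_map; rewrite -mem_perms.
Qed.

Lemma pgraftA u v w : pgraft u (pgraft v w) = pgraft (pgraft u v) w.
Proof.
rewrite /pgraft map_cat -catA -map_comp size_cat size_map; congr (_ ++ _).
by apply: eq_map => x /=; lia.
Qed.

Lemma nth_pgraft u v i :
  nth 0 (pgraft u v) i =
    if i < size u then size v + nth 0 u i else nth 0 v (i - size u).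
Proof.
by rewrite nth_cat size_map; case: ltnP => // h; rewrite (nth_map 0).
Qed.

Lemma size_pgraft u v : size (pgraft u v) = size u + size v.
Proof. by rewrite size_cat size_map. Qed.

(** Pairs with one position in each block are all inversions of [pgraft u v] and impose nothing on
    [x]; pairs inside a block keep their relative order under standardization. *)
Lemma weak_le_pgraft p q x u v :
  x \in perms (p + q) -> u \in perms p -> v \in perms q ->
  weak_le x (pgraft u v) = weak_le (st (take p x)) u && weak_le (st (drop p x)) v.
Proof.
move=> xn up vq; have xs := perms_size xn.
have us := perms_size up; have vs := perms_size vq.
have ts : size (take p x) = p by rewrite size_takel ?xs ?leq_addr.
have ds : size (drop p x) = q by rewrite size_drop xs addKn.
have cross a b : a < p -> p <= b -> b < p + q -> nth 0 (pgraft u v) b < nth 0 (pgraft u v) a.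
  move=> ap pb bn; rewrite !nth_pgraft us vs ap [b < p]ltnNge pb /=.
  have /andP [_ h1] : 0 < nth 0 v (b - p) <= q by apply: perms_nth vq _; lia.
  by have /andP [h2 _] := perms_nth up ap; lia.
have s2 := size_pgraft u v; rewrite us vs in s2.
apply/(weak_leP xs s2)/andP.
  move=> h; split; apply/(weak_leP _ _); rewrite ?size_st ?ts ?ds ?us ?vs => // i j ij jn.
    rewrite st_lt ?ts ?(ltn_trans ij jn) // !nth_take ?(ltn_trans ij jn) // => lt.
    have := h i j ij (leq_trans jn (leq_addr _ _)) lt.
    by rewrite !nth_pgraft us jn (ltn_trans ij jn) ltn_add2l.
  rewrite st_lt ?ds ?(ltn_trans ij jn) // !nth_drop => lt.
  have := h (p + i) (p + j); rewrite !ltn_add2l ij jn lt => /(_ isT isT isT).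
  have np k : (p + k < p) = false by lia.
  by rewrite !nth_pgraft us !np !addKn.
case=> /(weak_leP (n := p)) h1 /(weak_leP (n := q)) h2.
rewrite size_st ts us in h1; rewrite size_st ds vs in h2.
have {}h1 := h1 erefl erefl; have {}h2 := h2 erefl erefl.
move=> i j ij jn lt; case: (ltnP j p) => jp.
  have ip := ltn_trans ij jp; rewrite !nth_pgraft us ip jp ltn_add2l; apply: h1 => //.
  by rewrite st_lt ?ts // !nth_take.
case: (ltnP i p) => ip; first exact: cross.
rewrite !nth_pgraft us [j < p]ltnNge [i < p]ltnNge jp ip; apply: h2; [lia|lia|].
rewrite st_lt ?ds; [|lia|lia]; by rewrite !nth_drop !subnKC.
Qed.

(* The largest permutation in the fibre of [lam] over [t]; positions [i < j] form a
   noninversion of [gam t] iff node [i] lies in the left subtree of node [j]. *)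
Fixpoint gam (t : tree) : seq nat :=
  if t is Node l r then
    [seq nodes r + x | x <- gam l] ++ (nodes l + nodes r).+1 :: gam r
  else [::].

Lemma size_gam t : size (gam t) = nodes t.
Proof. by elim: t => //= l <- r <-; rewrite size_cat size_map /= addnS. Qed.

Lemma gam_node l r : gam (Node l r) = pgraft (gam (Node l Leaf)) (gam r).
Proof.
rewrite /pgraft /= !map_cat size_gam -catA /=; congr (_ ++ _ :: _); last by lia.
by rewrite -map_comp; apply: eq_map => x /=; lia.
Qed.

Lemma gam_Leaf l : gam (Node l Leaf) = gam l ++ [:: (nodes l).+1].
Proof. by rewrite /= addn0 map_id_in. Qed.

Lemma gam_perms t : gam t \in perms (nodes t).
Proof.
elim: t => // l IHl r IHr; rewrite gam_node.
have -> : nodes (Node l r) = (nodes l).+1 + nodes r by [].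
apply: pgraft_perms => //; rewrite mem_perms gam_Leaf.
have -> : iota 1 (nodes l).+1 = iota 1 (nodes l) ++ [:: (nodes l).+1].
  by rewrite -[in LHS](addn1 (nodes l)) iotaD.
by rewrite perm_cat2r -mem_perms.
Qed.

Lemma gam_lt t i j : i < j -> j < nodes t ->
  (nth 0 (gam t) i < nth 0 (gam t) j) = (j - nth 0 (lv t) j <= i).
Proof.
elim: t i j => // l IHl r IHr i j ij jn; rewrite nth_lv_node.
have ng k : nth 0 (gam (Node l r)) k =
    if k < nodes l then nodes r + nth 0 (gam l) k
    else if k == nodes l then (nodes l + nodes r).+1 else nth 0 (gam r) (k - (nodes l).+1).
  rewrite /= nth_cat size_map size_gam; case: ltnP => h; first by rewrite (nth_map 0) ?size_gam.
  case: eqP => [->|/eqP ne]; first by rewrite subnn.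
  by have -> : k - nodes l = (k - (nodes l).+1).+1 by lia.
rewrite !ng; move: jn; rewrite [nodes _]/= => jn.
have bl k : k < nodes l -> 0 < nth 0 (gam l) k <= nodes l by apply/perms_nth/gam_perms.
have br k : k < nodes r -> 0 < nth 0 (gam r) k <= nodes r by apply/perms_nth/gam_perms.
case: (ltngtP j (nodes l)) => jl.
- by rewrite (ltn_trans ij jl) ltn_add2l IHl.
- have jr : j - (nodes l).+1 < nodes r by lia.
  have := br _ jr; have := nth_lv_le r (j - (nodes l).+1).
  case: (ltngtP i (nodes l)) => il h1 h2.
  + by have := bl _ il; lia.
  + by rewrite IHr; lia.
  + by lia.
- have il : i < nodes l by lia.
  by rewrite il; have := bl i il; lia.
Qed.

(** In a decreasing tree the left subtree of node [j] is the longest run of positions ending just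
    before [j] with values below that of [j]. Quantifying over [k] expresses its length without a
    maximum. *)
Lemma lam_aux_spec f m s : s \in perms m -> m <= f ->
  nodes (lam_aux f s) = m /\
  forall j k, j < m -> k <= j ->
    (k <= nth 0 (lv (lam_aux f s)) j) <->
    (forall i, j - k <= i -> i < j -> nth 0 s i < nth 0 s j).
Proof.
elim: f m s => [|f IH] m s sm mf.
  have m0 : m = 0 by lia.
  by rewrite m0; split.
have ss := perms_size sm.
case: (posnP m) => [m0|m0].
  by rewrite (size0nil (etrans ss m0)) m0; split.
have ms : m \in s by rewrite (perms_mem _ sm) m0 leqnn.
have us := perms_uniq sm.
pose j0 := index m s; have j0m : j0 < m by rewrite -[X in _ < X]ss index_mem.
have nj0 : nth 0 s j0 = m by rewrite nth_index.
have -> : lam_aux f.+1 s = Node (lam_aux f (st (take j0 s))) (lam_aux f (st (drop j0.+1 s))).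
  by rewrite /j0 -ss; case: (s) (ss) => [e|//]; rewrite -e in m0.
have tp : st (take j0 s) \in perms j0.
  by rewrite -{2}(@size_takel j0 _ s) ?ss ?(ltnW j0m) // st_perms ?take_uniq.
have dp : st (drop j0.+1 s) \in perms (m - j0.+1).
  by rewrite -ss -size_drop st_perms ?drop_uniq.
have [n1 h1] := IH _ _ tp ltac:(lia); have [n2 h2] := IH _ _ dp ltac:(lia).
have st1 : size (take j0 s) = j0 by rewrite size_takel // ss ltnW.
have sd1 : size (drop j0.+1 s) = m - j0.+1 by rewrite size_drop ss.
have top i : i < m -> i != j0 -> nth 0 s i < m.
  move=> im ij; have /andP [_ h] := perms_nth sm im; rewrite ltn_neqAle h andbT.
  by rewrite -nj0 nth_uniq ?ss.
split=> [/=|j k jm kj]; first by rewrite n1 n2; lia.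
rewrite nth_lv_node n1; case: (ltngtP j j0) => jj.
- rewrite h1 //; split=> h i hi ij; have := h i hi ij;
    by rewrite st_lt ?st1 ?(ltn_trans ij jj) // !nth_take ?(ltn_trans ij jj).
(* Position [j] lies to the right of the maximum, so a run of more than [j - j0.+1] positions would
   contain [j0], whose value [m] is too large: both sides fail. *)
- case: (leqP k (j - j0.+1)) => kk; last first.
    split=> [h|h]; first by have := nth_lv_le (lam_aux f (st (drop j0.+1 s))) (j - j0.+1); lia.
    have := h j0; rewrite nj0 jj => /(_ ltac:(lia) isT).
    by have := top j jm; lia.
  rewrite h2 //; last by lia.
  have sh a : j0 < a -> nth 0 s a = nth 0 (drop j0.+1 s) (a - j0.+1).
    by move=> ja; rewrite nth_drop subnKC.
  split=> h i hi ij.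
    have := h (i - j0.+1) ltac:(lia) ltac:(lia).
    rewrite st_lt ?sd1; [|lia|lia]; by rewrite -!sh //; lia.
  rewrite st_lt ?sd1; [|lia|lia].
  by have := h (i + j0.+1) ltac:(lia) ltac:(lia); rewrite !sh ?addnK //; lia.
- split=> [_ i hi ij|_]; last by rewrite -jj.
  by rewrite jj nj0; apply: top; lia.
Qed.

Lemma lam_spec n s : s \in perms n ->
  nodes (lam s) = n /\
  forall j k, j < n -> k <= j ->
    (k <= nth 0 (lv (lam s)) j) <->
    (forall i, j - k <= i -> i < j -> nth 0 s i < nth 0 s j).
Proof. by move=> sn; apply: lam_aux_spec => //; rewrite (perms_size sn). Qed.

(** For fixed [j], the noninversions of [gam t] ending at [j] start at the [nth 0 (lv t) j]
    positions just before [j]. They are noninversions of [s] exactly when the run of smaller values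
    before [j] in [s] is at least that long. *)
Lemma weak_le_gam n s t : s \in perms n -> nodes t = n ->
  weak_le s (gam t) = lv_ge (lam s) t.
Proof.
move=> sn tn; have [ln lh] := lam_spec sn.
have gn : gam t \in perms n by rewrite -tn gam_perms.
apply/(weak_leP (perms_size sn) (perms_size gn))/lv_geP.
  move=> h; split=> [|j]; first by rewrite ln.
  case: (ltnP j n) => jn; last by rewrite nth_default // size_lv tn.
  apply/(lh _ _ jn); first exact: nth_lv_le.
  move=> i hi ij; have im := ltn_trans ij jn.
  have gl : nth 0 (gam t) i < nth 0 (gam t) j by rewrite gam_lt ?tn.
  have nij : i != j by rewrite ltn_eqF.
  rewrite (perms_ltNge sn) //; apply/negP => /(h _ _ ij jn) => lt.
  by have := ltn_trans lt gl; rewrite ltnn.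
case=> _ h i j ij jn lt; have im := ltn_trans ij jn.
have nji : j != i by rewrite gtn_eqF.
rewrite (perms_ltNge gn) // gam_lt ?tn //; apply/negP => hi.
have := (lh _ _ jn (nth_lv_le _ _)).1 (h j) i hi ij => lt'.
by have := ltn_trans lt lt'; rewrite ltnn.
Qed.

Lemma gamK t : lam (gam t) = t.
Proof.
have gp := gam_perms t; apply: lv_ge_anti.
  by rewrite -(weak_le_gam gp) ?weak_le_refl.
have [ln lh] := lam_spec gp; apply/lv_geP; split=> // j.
case: (ltnP j (nodes t)) => jn; last by rewrite nth_default // size_lv ln.
set k := nth _ _ _; have kj : k <= j by apply: nth_lv_le.
case: (posnP k) => [-> //|k0].
have := (lh _ k jn kj).1 (leqnn _) (j - k) (leqnn _) ltac:(lia).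
rewrite gam_lt //; lia.
Qed.

(** * 132-avoidance and last components *)

(** For distinct values this says that the positions before [k] carrying smaller values form an
    interval ending just before [k], the property visible in [gam_lt]. *)
Lemma avoids132P s :
  reflect (forall i j k, i < j -> j < k -> k < size s ->
             nth 0 s i < nth 0 s k -> nth 0 s j <= nth 0 s k)
          (avoids132 s).
Proof.
apply: (iffP allP) => [h i j k ij jk ks lt|h i].
  have js := ltn_trans jk ks; have iss := ltn_trans ij js.
  have /allP/(_ j) := h i ltac:(by rewrite mem_iota).
  rewrite mem_iota js => /(_ isT) /allP /(_ k); rewrite mem_iota ks => /(_ isT).
  by rewrite ij jk lt /= -leqNgt.
rewrite mem_iota => /= iss; apply/allP => j; rewrite mem_iota => /= js.
apply/allP => k; rewrite mem_iota => /= ks; apply/negP => /and4P [ij jk lt1].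
by rewrite ltnNge (h i j k).
Qed.

Lemma avoids132_st s : avoids132 (st s) = avoids132 s.
Proof.
apply/avoids132P/avoids132P; rewrite size_st => h i j k ij jk ks;
  have js := ltn_trans jk ks; have iss := ltn_trans ij js;
  have := h i j k ij jk ks; by rewrite !(leqNgt (nth _ _ j)) !st_lt.
Qed.

Lemma avoids132_drop g s : avoids132 s -> avoids132 (drop g s).
Proof.
move=> /avoids132P h; apply/avoids132P => i j k ij jk; rewrite size_drop => ks.
by rewrite !nth_drop; apply: h; lia.
Qed.

Lemma avoids132_gam t : avoids132 (gam t).
Proof.
apply/avoids132P => i j k ij jk; rewrite size_gam => ks.
rewrite gam_lt ?(ltn_trans ij jk) // => h; apply: ltnW.
by rewrite gam_lt // (leq_trans h) // ltnW.
Qed.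

(** If [s] avoids 132, a noninversion (i, j) forces all values from [i] up to [j] below that of [j],
    hence an entry of at least [j - i] in the vector of [lam s] and a noninversion of [gam (lam s)].
    The reverse comparison is the adjunction [weak_le_gam]. *)
Lemma lamK n s : s \in perms n -> avoids132 s -> gam (lam s) = s.
Proof.
move=> sn /avoids132P av; have [ln lh] := lam_spec sn; have ss := perms_size sn.
have gn : gam (lam s) \in perms n by rewrite -ln gam_perms.
apply: (weak_le_anti gn sn); last by rewrite (weak_le_gam sn ln) lv_ge_refl.
apply/(weak_leP (perms_size gn) ss) => i j ij jn; have im := ltn_trans ij jn.
have nji : j != i by rewrite gtn_eqF.
rewrite (perms_ltNge gn) // (perms_ltNge sn) //; apply: contra => lt.
rewrite gam_lt ?ln // leq_subLR addnC -leq_subLR; apply/lh => //; first exact: leq_subr.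
rewrite subKn ?(ltnW ij) // => i'; rewrite leq_eqVlt => /orP [/eqP <- //|ii] ij'.
rewrite ltn_neqAle nth_uniq ?ss ?(perms_uniq sn) ?(ltn_trans ij' jn) // (ltn_eqF ij') /=.
by apply: av ii ij' _ lt; rewrite ss.
Qed.

Lemma pgraft_st n g s : s \in perms n -> g <= n ->
  (forall x y, x \in take g s -> y \in drop g s -> y < x) ->
  s = pgraft (st (take g s)) (st (drop g s)).
Proof.
move=> sn gn cross; have ss := perms_size sn; have us := perms_uniq sn.
have ts : size (take g s) = g by rewrite size_takel ?ss.
have ds : size (drop g s) = n - g by rewrite size_drop ss.
have tp : st (take g s) \in perms g by rewrite -{2}ts st_perms // take_uniq.
have dp : st (drop g s) \in perms (n - g) by rewrite -ds st_perms // drop_uniq.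
have pp : pgraft (st (take g s)) (st (drop g s)) \in perms n.
  by rewrite -(subnKC gn) pgraft_perms // subnKC.
apply: (weak_le_anti sn pp).
  by rewrite (@weak_le_pgraft g (n - g)) ?subnKC // !weak_le_refl.
apply/(weak_leP (perms_size pp) ss) => i j ij jn; have im := ltn_trans ij jn.
rewrite !nth_pgraft !size_st ts; case: (ltnP j g) => jg.
  have ig := ltn_trans ij jg.
  by rewrite ig ltn_add2l st_lt ?ts // !nth_take.
case: (ltnP i g) => ig.
  move=> _; apply: cross.
    by rewrite -(nth_take _ ig) mem_nth ?ts.
  by rewrite -[j](subnKC jg) -nth_drop mem_nth // ds; lia.
rewrite st_lt ?ds; [|lia|lia]; by rewrite !nth_drop !subnKC.
Qed.

Lemma foldr_maxn_ge x s : x \in s -> x <= foldr maxn 0 s.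
Proof.
by elim: s => //= y s IH; rewrite inE leq_max => /predU1P [->|/IH ->]; rewrite ?leqnn ?orbT.
Qed.

Lemma foldr_maxn_mem s : foldr maxn 0 s != 0 -> foldr maxn 0 s \in s.
Proof.
elim: s => //= y s IH; case: (leqP (foldr maxn 0 s) y) => le h; rewrite inE ?eqxx //.
by rewrite IH ?orbT.
Qed.

Lemma last_comp_avoids132_mul n : 0 < n ->
  {in perms n, forall s, avoids132 (last_comp_perm s) <->
     exists p q u v, [/\ 0 < q, u \in perms p, v \in trees q & s = pgraft u (gam v)]}.
Proof.
move=> n0 s sn; have ss := perms_size sn; rewrite /last_comp_perm avoids132_st.
set D := [seq p <- _ | _]; set g := foldr maxn 0 D; split.
  move=> av.
  (* [g] is the last global descent, or the default 0 if there is none; in that case the last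
     component is all of [s] and [take g s] is empty. *)
  have gD : g != 0 -> is_gdesc s g by move/foldr_maxn_mem; rewrite mem_filter => /andP [].
  have gn : g < n.
    by have [->|/gD /andP [/andP [_]]] := eqVneq g 0; rewrite ?ss.
  have dp : st (drop g s) \in perms (n - g).
    by rewrite -ss -size_drop st_perms ?drop_uniq ?(perms_uniq sn).
  have [ln _] := lam_spec dp.
  exists g, (n - g), (st (take g s)), (lam (st (drop g s))); split.
  - by rewrite subn_gt0.
  - by rewrite -{2}(@size_takel g _ s) ?ss ?(ltnW gn) // st_perms ?take_uniq ?(perms_uniq sn).
  - by rewrite mem_trees ln.
  - rewrite (lamK dp) ?avoids132_st //; apply: (pgraft_st sn (ltnW gn)) => x y xs ys.
    have [g0|/gD /andP [_ /allP h]] := eqVneq g 0; first by rewrite g0 take0 in xs.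
    by have /allP/(_ y ys) := h x xs.
case=> p [q [u [v [q0 up]]]]; rewrite mem_trees => /eqP vq e.
have us := perms_size up.
have szm : size [seq size (gam v) + x | x <- u] = p by rewrite size_map.
(* [p] is 0 or a global descent, though perhaps not the last one, since [gam v] can have its own; in
   any case [drop g s] is a suffix of [gam v]. *)
have pg : p <= g.
  have [->|p0] := posnP p; first by [].
  apply: foldr_maxn_ge; rewrite mem_filter mem_iota add0n.
  have sz : size s = p + q by rewrite e size_pgraft us size_gam vq.
  have ps : p < size s by rewrite sz; lia.
  rewrite ps /is_gdesc p0 ps /= andbT e /pgraft take_size_cat // drop_size_cat //.
  apply/allP => _ /mapP [x xu ->]; apply/allP => y.
  rewrite (perms_mem _ (gam_perms v)) size_gam => /andP [_ yv].
  by move: xu; rewrite (perms_mem _ up); lia.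
have -> : drop g s = drop (g - p) (gam v).
  rewrite e /pgraft -{1}(subnK pg) -drop_drop.
  by rewrite drop_size_cat.
exact/avoids132_drop/avoids132_gam.
Qed.

(** Moves every progressive factor of [v] but the last into [u], which selects one normal form among
    the decompositions of a permutation. *)
Lemma pgraft_gam_progressive p u v : u \in perms p -> v != Leaf ->
  exists p' u' l, u' \in perms p' /\ pgraft u (gam v) = pgraft u' (gam (Node l Leaf)).
Proof.
elim: v p u => // l _ r IHr p u up _; have [->|nr] := eqVneq r Leaf.
  by exists p, u, l.
rewrite gam_node pgraftA; apply: (IHr (p + (nodes (Node l Leaf)))) => //.
exact/pgraft_perms/gam_perms.
Qed.

Lemma count_last_avoids132 n : 0 < n ->
  count (fun s => avoids132 (last_comp_perm s)) (perms n)
  = \sum_(k < n) k`! * size (trees (n - k - 1)).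
Proof.
move=> n0.
rewrite (@count_param _ _ n _ _
  (fun k => [seq (u, l) | u <- perms k, l <- trees (n - k - 1)])
  (fun k z => pgraft z.1 (gam (Node z.2 Leaf)))).
- apply: eq_bigr => k _; rewrite size_allpairs size_permutations ?iota_uniq //.
  by rewrite size_iota.
- exact: permutations_uniq.
- move=> k; apply: allpairs_uniq => [||[? ?] [? ?] _ _ /= [-> ->]] //.
    exact: permutations_uniq.
  exact: trees_uniq.
- move=> k z kn /allpairsP [[u l] /= [up]]; rewrite mem_trees => /eqP ln ->.
  have -> : n = k + nodes (Node l Leaf) by rewrite /= ln; lia.
  exact/pgraft_perms/gam_perms.
- move=> s sn; rewrite (last_comp_avoids132_mul n0 sn); split.
    case=> p [q [u [v [q0 up]]]]; rewrite mem_trees => /eqP vq e.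
    have nv : v != Leaf by apply/eqP => ev; rewrite -vq ev in q0.
    have [p' [u' [l [up' e']]]] := pgraft_gam_progressive up nv.
    rewrite e' in e; have := congr1 size e.
    rewrite (perms_size sn) size_pgraft (perms_size up') size_gam /= => sz.
    exists p', (u', l); split=> //; first by lia.
    apply/allpairsP; exists (u', l); split=> //=; rewrite mem_trees; apply/eqP; lia.
  case=> k [z [kn /allpairsP [[u l] /= [up]]]]; rewrite mem_trees => /eqP ln -> ->.
  by exists k, (nodes (Node l Leaf)), u, (Node l Leaf); rewrite mem_trees.
- move=> k k' z z' kn kn' /allpairsP [[u l] /= [up ln ->]] /allpairsP [[u' l'] /= [up' ln' ->]].
  rewrite -[RHS]/(pgraft u' (gam (Node l' Leaf))) -[LHS]/(pgraft u (gam (Node l Leaf))) => e.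
  rewrite !mem_trees in ln ln'.
  (* [gam (Node l Leaf)] ends with its largest value [(nodes l).+1], so the last letter determines
     [n - k] and with it the place of the cut. *)
  have := congr1 (last 0) e; rewrite /pgraft !gam_Leaf !catA !last_cat /= => e1.
  have ek : k = k' by move/eqP: ln; move/eqP: ln'; lia.
  subst k'; split=> //; move/eqP: e; rewrite /pgraft eqseq_cat; last first.
    by rewrite !size_map (perms_size up) (perms_size up').
  case/andP=> /eqP eu /eqP /(congr1 lam); rewrite !gamK => [[el]].
  rewrite el; congr pair; move: eu; rewrite el; apply: inj_map; exact: addnI.
Qed.

Lemma A_kernel_basis_dim n : 0 < n ->
  basis_of (A_kernel n) [seq MS n s | s <- perms n & ~~ avoids132 (last_comp_perm s)] /\
  \dim (A_kernel n) + \sum_(k < n) k`! * size (trees (n - k - 1)) = n`!.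
Proof.
move=> n0; rewrite -(count_last_avoids132 n0).
have -> : n`! = size (perms n) by rewrite size_permutations ?iota_uniq ?size_iota.
(* The kernel refers to no order on the target side, so [lv_ge] can serve there directly. *)
apply: (@hopf_kernel_basis_dim _ _ [::] Leaf perms trees copS Leaf
  size nodes weak_le lv_ge
  (fun p s => st (take p s)) (fun p s => lam (st (drop p s)))
  (fun u v => pgraft u (gam v))).
- exact: perms_poset.
- move=> p; split; first exact: trees_uniq.
  + by move=> t _; apply: lv_ge_refl.
  + by move=> s t _ _ /andP []; apply: lv_ge_anti.
  + by move=> t s u _ _ _; apply: lv_ge_trans.
- exact: perms_size.
- by move=> p t; rewrite mem_trees => /eqP.
- by move=> m s /perms_size sm; rewrite /copS sm.
- move=> m p s sm pm; have sp : size (take p s) = p by rewrite size_takel ?(perms_size sm).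
  by rewrite -{2}sp st_perms ?take_uniq ?(perms_uniq sm).
- move=> m p s sm pm.
  have dp : st (drop p s) \in perms (m - p).
    by rewrite -(perms_size sm) -size_drop st_perms ?drop_uniq ?(perms_uniq sm).
  by rewrite mem_trees (lam_spec dp).1.
- move=> p q u v up; rewrite mem_trees => /eqP <-; exact/pgraft_perms/gam_perms.
- move=> p q x u v xn up; rewrite mem_trees => /eqP vq.
  have gq : gam v \in perms q by rewrite -vq gam_perms.
  have dp : st (drop p x) \in perms q.
    by rewrite -(addKn p q) -(perms_size xn) -size_drop st_perms ?drop_uniq ?(perms_uniq xn).
  by rewrite (weak_le_pgraft xn up gq) (weak_le_gam dp vq).
- by [].
- by move=> p u _; rewrite /pgraft /= cats0 map_id_in.
- exact: last_comp_avoids132_mul.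
Qed.

Theorem theorem7p2 (n : nat) : 0 < n ->
  basis_of (A_kernel n)
    [seq MS n s | s <- perms n & ~~ avoids132 (last_comp_perm s)] /\
  basis_of (B_kernel n)
    [seq MY n t | t <- trees n & ~~ is_comb (last_comp_tree t)] /\
  Posz (\dim (A_kernel n)) =
    (Posz (n`!) - Posz (\sum_(k < n) k`! * catalan (n - k - 1)))%R /\
  Posz (\dim (B_kernel n)) =
    (Posz (catalan n) - Posz (\sum_(k < n) catalan k))%R.
Proof.
move=> n0; have [bA dA] := A_kernel_basis_dim n0; have [bB dB] := B_kernel_basis_dim n0.
split=> //; split=> //; split.
  have <- : \sum_(k < n) k`! * size (trees (n - k - 1)) =
      \sum_(k < n) k`! * catalan (n - k - 1).
    by apply: eq_bigr => k _; rewrite size_trees.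
  by rewrite -dA PoszD addrK.
have <- : \sum_(k < n) size (trees k) = \sum_(k < n) catalan k.
  by apply: eq_bigr => k _; rewrite size_trees.
by rewrite -(etrans dB (size_trees n)) PoszD addrK.
Qed.
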